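(* Let $M$ be a model of ZFA with set of atoms $A$, let $\Sigma\in M$ be a group of bijections of $A$, let $\mathcal{F}\in M$ be a normal filter of subgroups of $\Sigma$, and let $M'=M/\mathcal{F}$ be the resulting permutation model. Suppose that every $F\in\mathcal{F}$ contains a non-trivial internal automorphism, i.e. a non-identity element of $F\cap M'$. Then Frucht's Theorem fails in $M'$: there is a group in $M'$ which, in $M'$, is not isomorphic to the automorphism group of any graph.
   Context: ZFA is ZF modified to allow a set $A$ of atoms (objects with no elements, distinct from each other and from $\varnothing$; extensionality is restricted to non-atoms). A bijection $\pi$ of $A$ acts on the whole universe by its given action on atoms and, recursively, $\pi[S]=\{\pi[x]\mid x\in S\}$ for sets $S$. Let $\Sigma$ be a group of bijections of $A$ in $M$. For $S\in M$, $\operatorname{Stab}(S)=\{\sigma\in\Sigma\mid \sigma[S]=S\}$. A normal filter $\mathcal{F}$ of subgroups of $\Sigma$ is a family of subgroups of $\Sigma$ that is upwards closed (among subgroups) and closed under finite intersections, satisfies $\sigma\Psi\sigma^{-1}\in\mathcal{F}$ whenever $\Psi\in\mathcal{F}$ and $\sigma\in\Sigma$, and contains $\operatorname{Stab}(a)$ for each $a\in A$. An $S\in M$ is symmetric if $\operatorname{Stab}(S)\in\mathcal{F}$, and hereditarily symmetric if $S$ and every element of its transitive closure are symmetric. The permutation model $M'=M/\mathcal{F}$ is the class of hereditarily symmetric elements of $M$; it is a model of ZFA with the same set of atoms. Elements of $\Sigma\cap M'$ are called internal automorphisms of $A$. A graph is a pair $\langle V(G),E(G)\rangle$ with $V(G)$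 a set and $E(G)\subseteq V(G)^2$ symmetric and irreflexive; its automorphisms are the bijections of $V(G)$ preserving edges and non-edges. Frucht's Theorem is the statement that every group is isomorphic to the automorphism group of some graph. *)

(* Defs.v *)
Set Implicit Arguments.
Unset Strict Implicit.
Unset Printing Implicit Defensive.

(* A first-order structure for the language of set theory with atoms: an
   arbitrary carrier, so neither transitive nor well-founded models are singled
   out.  All set-theoretic notions below are first-order formulas evaluated in
   such a structure; instantiating [N] with a permutation model evaluates them
   inside that model. *)
Record structure : Type := Structure {
  dom :> Type;
  mem : dom -> dom -> Prop;
  atom : dom -> Prop
}.

Arguments mem {s} _ _.
Arguments atom {s} _.

Notation "x ∈ y" := (mem x y) (at level 70, no associativity).

(* Formulas with de Bruijn variables; an environment [nat -> N] assigns the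
   values of the parameters. *)
Inductive form : Type :=
| fMem (i j : nat)
| fEq (i j : nat)
| fAtom (i : nat)
| fBot
| fImp (p q : form)
| fAnd (p q : form)
| fOr (p q : form)
| fAll (p : form)
| fEx (p : form).

Definition scons (N : structure) (x : N) (e : nat -> N) : nat -> N :=
  fun n => match n with O => x | S k => e k end.

Fixpoint sat (N : structure) (e : nat -> N) (p : form) : Prop :=
  match p with
  | fMem i j => e i ∈ e j
  | fEq i j => e i = e j
  | fAtom i => atom (e i)
  | fBot => False
  | fImp p q => sat e p -> sat e q
  | fAnd p q => sat e p /\ sat e q
  | fOr p q => sat e p \/ sat e q
  | fAll p => forall x : N, sat (scons x e) p
  | fEx p => exists x : N, sat (scons x e) p
  end.

Section SetTheory.

Variable N : structure.
Implicit Types x y z w p q f g h s t u v X Y : N.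

(* [z] is the set {w | P w}. *)
Definition is_ext z (P : N -> Prop) : Prop :=
  ~ atom z /\ forall w, w ∈ z <-> P w.

Definition subset x y : Prop := forall w, w ∈ x -> w ∈ y.

Record ZFA : Prop := {
  zfa_atom_no_elements : forall x y, atom x -> ~ y ∈ x;
  zfa_atoms_set : exists X, is_ext X (fun w => atom w);
  zfa_extensionality : forall x y, ~ atom x -> ~ atom y ->
    (forall w, w ∈ x <-> w ∈ y) -> x = y;
  zfa_empty : exists z, is_ext z (fun _ => False);
  zfa_pairing : forall x y, exists z, is_ext z (fun w => w = x \/ w = y);
  zfa_union : forall x, exists z, is_ext z (fun w => exists y, y ∈ x /\ w ∈ y);
  zfa_power : forall x, exists z, is_ext z (fun w => ~ atom w /\ subset w x);
  zfa_infinity : exists z,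
    (exists y, is_ext y (fun _ => False) /\ y ∈ z) /\
    (forall x, x ∈ z -> exists y, is_ext y (fun w => w ∈ x \/ w = x) /\ y ∈ z);
  zfa_foundation : forall x, (exists y, y ∈ x) ->
    exists y, y ∈ x /\ forall z, z ∈ y -> ~ z ∈ x;
  zfa_separation : forall (phi : form) (e : nat -> N) x,
    exists z, is_ext z (fun w => w ∈ x /\ sat (scons w e) phi);
  (* In [phi], variable 0 is the argument and variable 1 the value. *)
  zfa_replacement : forall (phi : form) (e : nat -> N) x,
    (forall u v v', u ∈ x -> sat (scons u (scons v e)) phi ->
       sat (scons u (scons v' e)) phi -> v = v') ->
    exists z, is_ext z (fun v => exists u, u ∈ x /\ sat (scons u (scons v e)) phi)
}.

Definition is_atom_set X : Prop := is_ext X (fun w => atom w).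

Definition is_upair z x y : Prop := is_ext z (fun w => w = x \/ w = y).

(* Kuratowski pair *)
Definition is_pair p x y : Prop :=
  exists s u, is_upair s x x /\ is_upair u x y /\ is_upair p s u.

Definition app f x y : Prop := exists p, is_pair p x y /\ p ∈ f.

Definition is_prod z X Y : Prop :=
  is_ext z (fun p => exists x y, x ∈ X /\ y ∈ Y /\ is_pair p x y).

Definition is_fun f X Y : Prop :=
  ~ atom f /\ ~ atom X /\ ~ atom Y /\
  (forall p, p ∈ f -> exists x y, x ∈ X /\ y ∈ Y /\ is_pair p x y) /\
  (forall x, x ∈ X -> exists! y, app f x y).

Definition is_bij f X Y : Prop :=
  is_fun f X Y /\ forall y, y ∈ Y -> exists! x, app f x y.

Definition is_identity X f : Prop :=
  is_ext f (fun p => exists x, x ∈ X /\ is_pair p x x).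

(* h is g ∘ f. *)
Definition is_comp h g f : Prop :=
  is_ext h (fun p => exists x y z, is_pair p x z /\ app f x y /\ app g y z).

Definition is_inverse g f : Prop :=
  is_ext g (fun p => exists x y, is_pair p y x /\ app f x y).

Definition transitive t : Prop := forall y z, y ∈ t -> z ∈ y -> z ∈ t.

Definition is_transitive_closure t x : Prop :=
  ~ atom t /\ transitive t /\ subset x t /\
  forall s, ~ atom s -> transitive s -> subset x s -> subset t s.

(* m is a function on the set of pairs X × X. *)
Definition op (m : N) x y z : Prop := exists p, is_pair p x y /\ app m p z.

Definition is_group_with (G X m : N) : Prop :=
  is_pair G X m /\
  (exists Q, is_prod Q X X /\ is_fun m Q X) /\
  (forall x y z u v w w', x ∈ X -> y ∈ X -> z ∈ X ->
     op m x y u -> op m u z w -> op m y z v -> op m x v w' -> w = w') /\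
  (exists e, e ∈ X /\
     (forall x, x ∈ X -> op m e x x /\ op m x e x) /\
     (forall x, x ∈ X -> exists y, y ∈ X /\ op m x y e /\ op m y x e)).

Definition is_group (G : N) : Prop := exists X m, is_group_with G X m.

Definition is_group_iso (phi G H : N) : Prop :=
  exists X m Y n, is_group_with G X m /\ is_group_with H Y n /\
    is_bij phi X Y /\
    forall x y z x' y' z', op m x y z ->
      app phi x x' -> app phi y y' -> app phi z z' -> op n x' y' z'.

Definition group_isomorphic (G H : N) : Prop := exists phi, is_group_iso phi G H.

Definition is_graph_with (Gamma V E : N) : Prop :=
  is_pair Gamma V E /\ ~ atom V /\ ~ atom E /\
  (forall p, p ∈ E -> exists x y, x ∈ V /\ y ∈ V /\ is_pair p x y) /\
  (forall x y, app E x y -> app E y x) /\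
  (forall x, ~ app E x x).

Definition is_graph (Gamma : N) : Prop := exists V E, is_graph_with Gamma V E.

Definition is_graph_aut (V E f : N) : Prop :=
  is_bij f V V /\
  forall x y x' y', app f x x' -> app f y y' -> (app E x y <-> app E x' y').

(* n is the map (g, f) |-> g ∘ f on Y × Y. *)
Definition is_aut_group (H Gamma : N) : Prop :=
  exists V E Y n, is_graph_with Gamma V E /\ is_pair H Y n /\
    is_ext Y (fun f => is_graph_aut V E f) /\
    is_ext n (fun p => exists g f h q, g ∈ Y /\ f ∈ Y /\ is_comp h g f /\
                         is_pair q g f /\ is_pair p q h).

Definition Frucht : Prop :=
  forall G, is_group G ->
    exists Gamma H, is_graph Gamma /\ is_aut_group H Gamma /\ group_isomorphic G H.

(* f is the restriction to the transitive set t of the action of pi, given by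
   recursion on membership. *)
Definition is_action_on (pi t f : N) : Prop :=
  ~ atom t /\ transitive t /\ ~ atom f /\
  (forall p, p ∈ f -> exists x y, x ∈ t /\ is_pair p x y) /\
  (forall x, x ∈ t -> exists! y, app f x y) /\
  (forall x y, app f x y -> atom x -> app pi x y) /\
  (forall x y, app f x y -> ~ atom x ->
     is_ext y (fun w => exists v, v ∈ x /\ app f v w)).

(* pi[x] = y *)
Definition acts (pi x y : N) : Prop :=
  exists t f, is_action_on pi t f /\ app f x y.

Definition is_perm_group (A Sigma : N) : Prop :=
  ~ atom Sigma /\
  (forall f, f ∈ Sigma -> is_bij f A A) /\
  (exists i, is_identity A i /\ i ∈ Sigma) /\
  (forall g f, g ∈ Sigma -> f ∈ Sigma -> exists h, is_comp h g f /\ h ∈ Sigma) /\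
  (forall f, f ∈ Sigma -> exists g, is_inverse g f /\ g ∈ Sigma).

Definition is_subgroup (A Psi Sigma : N) : Prop :=
  is_perm_group A Psi /\ subset Psi Sigma.

Definition is_stab (Sigma T x : N) : Prop :=
  is_ext T (fun sigma => sigma ∈ Sigma /\ acts sigma x x).

(* Theta is σΨσ⁻¹. *)
Definition is_conjugate (Theta sigma Psi : N) : Prop :=
  is_ext Theta (fun tau => exists psi rho u, psi ∈ Psi /\
     is_inverse rho sigma /\ is_comp u sigma psi /\ is_comp tau u rho).

(* The second clause is closure under the empty intersection; it excludes the
   empty family, which the remaining clauses would allow if A = ∅. *)
Definition is_normal_filter (A Sigma F : N) : Prop :=
  ~ atom F /\
  Sigma ∈ F /\
  (forall Psi, Psi ∈ F -> is_subgroup A Psi Sigma) /\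
  (forall Psi Phi, Psi ∈ F -> is_subgroup A Phi Sigma -> subset Psi Phi -> Phi ∈ F) /\
  (forall Psi Phi, Psi ∈ F -> Phi ∈ F ->
     exists Theta, is_ext Theta (fun s => s ∈ Psi /\ s ∈ Phi) /\ Theta ∈ F) /\
  (forall Psi sigma, Psi ∈ F -> sigma ∈ Sigma ->
     exists Theta, is_conjugate Theta sigma Psi /\ Theta ∈ F) /\
  (forall a, a ∈ A -> exists T, is_stab Sigma T a /\ T ∈ F).

Definition symmetric (Sigma F x : N) : Prop :=
  exists T, is_stab Sigma T x /\ T ∈ F.

Definition hereditarily_symmetric (Sigma F x : N) : Prop :=
  symmetric Sigma F x /\
  exists t, is_transitive_closure t x /\ forall y, y ∈ t -> symmetric Sigma F y.

End SetTheory.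

Definition permutation_model (M : structure) (Sigma F : M) : structure :=
  {| dom := {x : M | hereditarily_symmetric Sigma F x};
     mem := fun x y => proj1_sig x ∈ proj1_sig y;
     atom := fun x => atom (proj1_sig x) |}.

(* Main.v *)
From Stdlib Require Import Classical ProofIrrelevance.
Require Import Defs.

(** The group is the family [X] of all sets of atoms of the permutation model
    [N], under symmetric difference.  It is abelian, and every permutation that
    moves an atom [a] moves the element [{a}] of it.

    Suppose that [N] contains a graph on [V] with edge set [E] and an
    isomorphism [phi] from [X] to its automorphism group.  The stabilizers of
    [V], [E] and [phi] meet in a member of the filter, so some internal
    automorphism [s], not the identity, fixes these three sets.  The function
    [f : v |-> s[v]] on [V] belongs to [N] because [s] does: a permutation that
    fixes [s] and [V] fixes [f] ([induced_map_exists]).  Since [s] fixes [V] and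
    [E], [f] is an automorphism of the graph, hence [f = phi(g)] for some [g] in
    [X].  Since [s] fixes [phi], for every [x] in [X]

      [phi(s[x]) = s[phi(x)] = f o phi(x) o f^-1]

    ([induced_map_conjugates]), which is [phi] of the conjugate of [x] by [g].
    So [s] acts on [X] as an inner automorphism, that is, trivially, although it
    moves some [{a}].

    The rest of the work is to make sense of this inside a first-order structure
    satisfying ZFA.  Separation and replacement are schemes over formulas, so
    classes are handled through the predicate [definable], closed under the
    connectives.  Induction on membership holds for definable classes and for
    sets that possess a transitive closure ([grounded_induction]); hereditarily
    symmetric sets do by definition, and sets built from them do by
    [grounded_intro].  This yields existence and uniqueness of the action of a permutation
    ([acts_total], [acts_unique]) and its equivariance.  Hereditary symmetry of
    the sets put into the model rests on [hs_intro] and [hs_set]; pairs, function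
    application and symmetric differences are absolute between the model and the
    ambient structure, so the facts about the action transfer. *)

(** * Definable classes *)

Section Definability.

Context {M : structure}.
Implicit Types P Q : (nat -> M) -> Prop.

Definition definable P : Prop := exists phi, forall e, sat e phi <-> P e.

Lemma definable_mem i j : definable (fun e => e i ∈ e j).
Proof. exists (fMem i j); reflexivity. Qed.

Lemma definable_eq i j : definable (fun e => e i = e j).
Proof. exists (fEq i j); reflexivity. Qed.

Lemma definable_atom i : definable (fun e => atom (e i)).
Proof. exists (fAtom i); reflexivity. Qed.

Lemma definable_False : definable (fun _ => False).
Proof. exists fBot; reflexivity. Qed.

Lemma definable_imp P Q :
  definable P -> definable Q -> definable (fun e => P e -> Q e).
Proof.
  intros [p Hp] [q Hq]; exists (fImp p q); intros e; cbn.
  now rewrite Hp, Hq.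
Qed.

Lemma definable_and P Q :
  definable P -> definable Q -> definable (fun e => P e /\ Q e).
Proof.
  intros [p Hp] [q Hq]; exists (fAnd p q); intros e; cbn.
  now rewrite Hp, Hq.
Qed.

Lemma definable_or P Q :
  definable P -> definable Q -> definable (fun e => P e \/ Q e).
Proof.
  intros [p Hp] [q Hq]; exists (fOr p q); intros e; cbn.
  now rewrite Hp, Hq.
Qed.

Lemma definable_not P : definable P -> definable (fun e => ~ P e).
Proof. intros HP; exact (definable_imp P _ HP definable_False). Qed.

Lemma definable_iff P Q :
  definable P -> definable Q -> definable (fun e => P e <-> Q e).
Proof. intros; now apply definable_and; apply definable_imp. Qed.

(** The bound variable is variable 0 and the outer ones are shifted.  [Q] takes
    the outer environment and the bound value separately, so that it is found by
    pattern unification with the body of a quantifier. *)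
Lemma definable_all (Q : (nat -> M) -> M -> Prop) :
  definable (fun e => Q (fun n => e (S n)) (e 0)) ->
  definable (fun e => forall x, Q e x).
Proof.
  intros [q Hq]; exists (fAll q); intros e; cbn.
  split; intros H x; [apply (Hq (scons x e)) | apply Hq]; apply H.
Qed.

Lemma definable_ex (Q : (nat -> M) -> M -> Prop) :
  definable (fun e => Q (fun n => e (S n)) (e 0)) ->
  definable (fun e => exists x, Q e x).
Proof.
  intros [q Hq]; exists (fEx q); intros e; cbn.
  split; intros [x Hx]; exists x; [apply (Hq (scons x e)) | apply Hq]; apply Hx.
Qed.

End Definability.

Create HintDb definability.
Hint Resolve definable_mem definable_eq definable_atom definable_False
  definable_and definable_or definable_not definable_iff : definability.
Hint Resolve definable_imp definable_all definable_ex | 5 : definability.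

(* Unfolding [unique] reduces [exists!] to connectives that have a lemma. *)
Ltac definability := unfold unique; cbn beta; eauto 60 with definability nocore.

Section DefinableNotions.

Context {M : structure}.
Implicit Types i j k l : nat.

Lemma definable_pair i j k :
  definable (fun e : nat -> M => is_pair (e i) (e j) (e k)).
Proof. unfold is_pair, is_upair, is_ext; definability. Qed.
Hint Resolve definable_pair : definability.

Lemma definable_app i j k :
  definable (fun e : nat -> M => app (e i) (e j) (e k)).
Proof. unfold app; definability. Qed.
Hint Resolve definable_app : definability.

Lemma definable_subset i j :
  definable (fun e : nat -> M => subset (e i) (e j)).
Proof. unfold subset; definability. Qed.
Hint Resolve definable_subset : definability.

Lemma definable_transitive i :
  definable (fun e : nat -> M => transitive (e i)).
Proof. unfold transitive; definability. Qed.
Hint Resolve definable_transitive : definability.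

Lemma definable_transitive_closure i j :
  definable (fun e : nat -> M => is_transitive_closure (e i) (e j)).
Proof. unfold is_transitive_closure; definability. Qed.
Hint Resolve definable_transitive_closure : definability.

Lemma definable_acts i j k :
  definable (fun e : nat -> M => acts (e i) (e j) (e k)).
Proof. unfold acts, is_action_on, is_ext; definability. Qed.
Hint Resolve definable_acts : definability.

Lemma definable_symmetric i j k :
  definable (fun e : nat -> M => symmetric (e i) (e j) (e k)).
Proof. unfold symmetric, is_stab, is_ext; definability. Qed.

End DefinableNotions.

Hint Resolve definable_pair definable_app definable_subset
  definable_transitive definable_transitive_closure definable_acts
  definable_symmetric : definability.

(** * Elementary set theory with atoms *)

Section PermutationModel.

Context {M : structure} (HM : ZFA M).
Implicit Types x y z w p q f g h s t u v X Y : M.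

(** The separation and replacement schemes for definable classes.  Here [e]
    supplies the parameters, from variable 1 on for separation and from
    variable 2 on for replacement. *)
Lemma separation (P : (nat -> M) -> Prop) (HP : definable P) e x :
  exists z, is_ext z (fun w => w ∈ x /\ P (scons w e)).
Proof.
  destruct HP as [phi Hphi].
  destruct (zfa_separation HM phi e x) as [z [Hz Hzw]].
  exists z; split; [exact Hz|]; intros w; rewrite Hzw, Hphi; reflexivity.
Qed.

Lemma replacement (P : (nat -> M) -> Prop) (HP : definable P) e x :
  (forall u v v', u ∈ x -> P (scons u (scons v e)) ->
     P (scons u (scons v' e)) -> v = v') ->
  exists z, is_ext z (fun v => exists u, u ∈ x /\ P (scons u (scons v e))).
Proof.
  intros Hfun; destruct HP as [phi Hphi].
  destruct (zfa_replacement HM (phi := phi) (e := e) (x := x)) as [z [Hz Hzw]].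
  { intros u v v' Hu H H'; rewrite Hphi in H, H'; eauto. }
  exists z; split; [exact Hz|]; intros w; rewrite Hzw.
  split; intros [u [Hu H]]; exists u; (split; [exact Hu|]); apply Hphi, H.
Qed.

Lemma not_atom_of_mem x y : y ∈ x -> ~ atom x.
Proof. intros Hy Hx; exact (zfa_atom_no_elements HM Hx Hy). Qed.

Lemma ext_unique z z' (P : M -> Prop) : is_ext z P -> is_ext z' P -> z = z'.
Proof.
  intros [Hz H] [Hz' H']; apply (zfa_extensionality HM Hz Hz').
  intros w; rewrite H, H'; reflexivity.
Qed.

Lemma ext_iff z (P Q : M -> Prop) :
  is_ext z P -> (forall w, P w <-> Q w) -> is_ext z Q.
Proof. intros [Hz H] HPQ; split; [exact Hz|]; intros w; now rewrite H. Qed.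

Lemma binary_union x y : exists z, is_ext z (fun w => w ∈ x \/ w ∈ y).
Proof.
  destruct (zfa_pairing HM x y) as [u [_ Hu]].
  destruct (zfa_union HM u) as [z Hz]; exists z.
  apply (ext_iff _ _ _ Hz); intros w; split.
  - intros [r [Hr Hw]]; apply Hu in Hr; destruct Hr as [->| ->]; tauto.
  - intros [Hw|Hw]; [exists x | exists y]; (split; [apply Hu|]; tauto).
Qed.

Lemma adjoin x y : exists z, is_ext z (fun w => w ∈ x \/ w = y).
Proof.
  destruct (zfa_pairing HM y y) as [u [_ Hu]].
  destruct (binary_union x u) as [z Hz]; exists z.
  apply (ext_iff _ _ _ Hz); intros w; rewrite Hu; tauto.
Qed.

Lemma pair_exists x y : exists p, is_pair p x y.
Proof.
  destruct (zfa_pairing HM x x) as [s Hs], (zfa_pairing HM x y) as [u Hu].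
  destruct (zfa_pairing HM s u) as [p Hp]; exists p, s, u; auto.
Qed.

Lemma pair_unique p p' x y : is_pair p x y -> is_pair p' x y -> p = p'.
Proof.
  intros [s [u [Hs [Hu Hp]]]] [s' [u' [Hs' [Hu' Hp']]]].
  rewrite (ext_unique _ _ _ Hs' Hs), (ext_unique _ _ _ Hu' Hu) in Hp'.
  exact (ext_unique _ _ _ Hp Hp').
Qed.

Lemma upair_inj u x y x' y' :
  is_upair u x y -> is_upair u x' y' -> (x = x' /\ y = y') \/ (x = y' /\ y = x').
Proof.
  intros [_ H] [_ H'].
  assert (E : forall w, (w = x \/ w = y) <-> (w = x' \/ w = y')).
  { intros w; now rewrite <- H, <- H'. }
  destruct (proj1 (E x) (or_introl eq_refl)) as [-> | ->];
    destruct (proj1 (E y) (or_intror eq_refl)) as [-> | ->];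
    destruct (proj2 (E x') (or_introl eq_refl)) as [? | ?];
    destruct (proj2 (E y') (or_intror eq_refl)) as [? | ?]; subst; auto.
Qed.

Lemma pair_inj p x y x' y' : is_pair p x y -> is_pair p x' y' -> x = x' /\ y = y'.
Proof.
  intros [s [u [Hs [Hu Hp]]]] [s' [u' [Hs' [Hu' Hp']]]].
  destruct (upair_inj _ _ _ _ _ Hp Hp') as [[-> ->] | [-> ->]].
  - destruct (upair_inj _ _ _ _ _ Hs Hs') as [[-> _] | [-> _]];
      destruct (upair_inj _ _ _ _ _ Hu Hu') as [[? ?] | [? ?]]; subst; auto.
  - destruct (upair_inj _ _ _ _ _ Hs Hu') as [[? ?] | [? ?]];
      destruct (upair_inj _ _ _ _ _ Hu Hs') as [[? ?] | [? ?]]; subst; auto.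
Qed.

Lemma app_pair f p x y : is_pair p x y -> (app f x y <-> p ∈ f).
Proof.
  intros Hp; split.
  - intros [q [Hq Hqf]]; now rewrite (pair_unique _ _ _ _ Hp Hq).
  - intros Hpf; now exists p.
Qed.

Lemma product_exists X Y : exists z, is_prod z X Y.
Proof.
  destruct (binary_union X Y) as [U [_ HU]].
  destruct (zfa_power HM U) as [U1 [_ HU1]].
  destruct (zfa_power HM U1) as [U2 [_ HU2]].
  destruct (separation
    (fun e => exists x y, x ∈ e 1 /\ y ∈ e 2 /\ is_pair (e 0) x y)
    ltac:(definability) (scons X (scons Y (fun _ => X))) U2) as [z Hz].
  exists z; apply (ext_iff _ _ _ Hz); intros p; cbn.
  split; [now intros [_ H]|]; intros H; split; [|exact H].
  destruct H as [x [y [Hx [Hy [s [u [Hs [Hu Hp]]]]]]]].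
  destruct Hs as [Hs0 Hs], Hu as [Hu0 Hu], Hp as [Hp0 Hp].
  apply HU2; split; [exact Hp0|].
  intros w Hw; apply HU1; apply Hp in Hw.
  destruct Hw as [-> | ->]; split; trivial; intros r Hr; apply HU;
    [apply Hs in Hr | apply Hu in Hr]; destruct Hr as [-> | ->]; tauto.
Qed.

Lemma fun_value f X Y x : is_fun f X Y -> x ∈ X -> exists y, app f x y.
Proof.
  intros [_ [_ [_ [_ H]]]] Hx; destruct (H x Hx) as [y [Hy _]]; now exists y.
Qed.

Lemma fun_dom_cod f X Y x y : is_fun f X Y -> app f x y -> x ∈ X /\ y ∈ Y.
Proof.
  intros [_ [_ [_ [H _]]]] [p [Hp Hpf]].
  destruct (H p Hpf) as [x' [y' [Hx [Hy Hp']]]].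
  destruct (pair_inj _ _ _ _ _ Hp Hp') as [-> ->]; auto.
Qed.

Lemma fun_unique f X Y x y y' : is_fun f X Y -> app f x y -> app f x y' -> y = y'.
Proof.
  intros Hf Hy Hy'; destruct (fun_dom_cod _ _ _ _ _ Hf Hy) as [Hx _].
  destruct Hf as [_ [_ [_ [_ H]]]], (H x Hx) as [z [_ Hz]].
  rewrite <- (Hz y Hy); auto.
Qed.

(** * Transitive closures and induction on membership *)

Definition grounded x : Prop := exists t, is_transitive_closure t x.

Lemma transitive_closure_unique t t' x :
  is_transitive_closure t x -> is_transitive_closure t' x -> t = t'.
Proof.
  intros [Ht [Htt [Hx H]]] [Ht' [Htt' [Hx' H']]].
  apply (zfa_extensionality HM Ht Ht'); intros w; split; [apply H | apply H']; auto.
Qed.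

Lemma grounded_of_transitive x t :
  ~ atom t -> transitive t -> subset x t -> grounded x.
Proof.
  intros Ht Htt Hx.
  destruct (separation
    (fun e => forall s, ~ atom s -> transitive s -> subset (e 1) s -> e 0 ∈ s)
    ltac:(definability) (scons x (fun _ => x)) t) as [c [Hc0 Hc]]; cbn in Hc.
  exists c; split; [exact Hc0|split; [|split]].
  - intros y z Hy Hz; apply Hc in Hy; apply Hc; destruct Hy as [Hyt Hy].
    split; [exact (Htt y z Hyt Hz)|]; intros s Hs Hss Hxs.
    exact (Hss y z (Hy s Hs Hss Hxs) Hz).
  - intros y Hy; apply Hc; split; [auto|]; intros s _ _ Hs; auto.
  - intros s Hs Hss Hxs y Hy; apply Hc in Hy; now apply Hy.
Qed.

Lemma grounded_elem x y : grounded x -> y ∈ x -> grounded y.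
Proof.
  intros [t [Ht [Htt [Hx _]]]] Hy; apply (grounded_of_transitive y t); auto.
  intros w Hw; apply (Htt y w); auto.
Qed.

(** The closure of [x] is assembled by replacement from those of its elements,
    where uniqueness of closures makes the replacement functional. *)
Lemma grounded_intro x : (forall y, y ∈ x -> grounded y) -> grounded x.
Proof.
  intros Hx.
  destruct (replacement (fun e => is_transitive_closure (e 1) (e 0))
    ltac:(definability) (fun _ => x) x) as [C [_ HC]].
  { cbn; intros u v v' _; apply transitive_closure_unique. }
  cbn in HC; destruct (zfa_union HM C) as [U [_ HU]].
  destruct (binary_union x U) as [t [Ht0 Ht]].
  assert (sub : forall y w, y ∈ x -> w ∈ y -> w ∈ U).
  { intros y w Hy Hw; destruct (Hx y Hy) as [c Hc]; apply HU; exists c; split.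
    - apply HC; now exists y.
    - destruct Hc as [_ [_ [Hyc _]]]; auto. }
  apply (grounded_of_transitive x t Ht0).
  - intros y z Hy Hz; apply Ht; right; apply Ht in Hy.
    destruct Hy as [Hy|Hy]; [now apply (sub y)|].
    apply HU in Hy; destruct Hy as [c [Hc Hy]]; apply HU; exists c.
    split; [exact Hc|]; apply HC in Hc; destruct Hc as [r [_ [_ [Hct _]]]].
    exact (Hct y z Hy Hz).
  - intros y Hy; apply Ht; auto.
Qed.

Lemma grounded_atom x : atom x -> grounded x.
Proof.
  intros Hx; apply grounded_intro; intros y Hy; now destruct (not_atom_of_mem _ _ Hy).
Qed.

Lemma grounded_pair p x y : grounded x -> grounded y -> is_pair p x y -> grounded p.
Proof.
  intros Hx Hy [s [u [[_ Hs] [[_ Hu] [_ Hp]]]]].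
  apply grounded_intro; intros w Hw; apply grounded_intro; intros r Hr.
  apply Hp in Hw; destruct Hw as [-> | ->];
    [apply Hs in Hr | apply Hu in Hr]; destruct Hr as [-> | ->]; auto.
Qed.

Lemma grounded_pair_inv p x y : grounded p -> is_pair p x y -> grounded x /\ grounded y.
Proof.
  intros Hg [s [u [[_ Hs] [[_ Hu] [_ Hp]]]]].
  assert (Hgu : grounded u) by (apply (grounded_elem p); [exact Hg|apply Hp; auto]).
  split; apply (grounded_elem u); trivial; apply Hu; auto.
Qed.

(** Foundation speaks of sets only; within the transitive closure of [x] it
    gives the induction principle. *)
Lemma grounded_induction (P : (nat -> M) -> Prop) (HP : definable P) e :
  (forall x, grounded x -> (forall v, v ∈ x -> P (scons v e)) -> P (scons x e)) ->
  forall x, grounded x -> P (scons x e).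
Proof.
  intros step x Hx; apply NNPP; intros HnP.
  destruct Hx as [t [Ht [Htt [Hxt Hmin]]]].
  assert (Hgt : forall y, y ∈ t -> grounded y).
  { intros y Hy; apply (grounded_of_transitive y t); trivial.
    intros w; exact (Htt y w Hy). }
  destruct (adjoin t x) as [t' [_ Ht']].
  destruct (separation (fun e => ~ P e) ltac:(now apply definable_not) e t')
    as [D [_ HD]].
  destruct (zfa_foundation HM (x := D)) as [y [HyD Hy]].
  { exists x; apply HD; split; [apply Ht'|]; auto. }
  apply HD in HyD; destruct HyD as [Hyt HnPy]; apply HnPy, step.
  - apply Ht' in Hyt; destruct Hyt as [Hyt | ->]; [auto|now exists t].
  - intros v Hv; apply NNPP; intros HnPv; apply (Hy v Hv), HD; split; trivial.
    apply Ht'; left; apply Ht' in Hyt; destruct Hyt as [Hyt | ->]; [|auto].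
    exact (Htt y v Hyt Hv).
Qed.

(** * The action of a bijection of the atoms *)

(** The recursion defining the action has at most one solution, on any transitive
    set: the least point of disagreement would be a set whose elements are moved
    in the same way. *)
Lemma action_agree A pi t f t' f' :
  is_fun pi A A -> is_action_on pi t f -> is_action_on pi t' f' ->
  forall x y y', app f x y -> app f' x y' -> y = y'.
Proof.
  intros Hpi [Ht [Htt [_ [Hdom [Htot [Hat Hset]]]]]]
    [Ht' [Htt' [_ [Hdom' [Htot' [Hat' Hset']]]]]].
  assert (dom : forall x y, app f x y -> x ∈ t).
  { intros x y [p [Hp Hpf]]; destruct (Hdom p Hpf) as [x' [y' [Hx Hp']]].
    now destruct (pair_inj _ _ _ _ _ Hp Hp') as [-> _]. }
  assert (dom' : forall x y, app f' x y -> x ∈ t').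
  { intros x y [p [Hp Hpf]]; destruct (Hdom' p Hpf) as [x' [y' [Hx Hp']]].
    now destruct (pair_inj _ _ _ _ _ Hp Hp') as [-> _]. }
  assert (key : forall x, grounded x ->
    forall y y', app f x y -> app f' x y' -> y = y').
  { apply (grounded_induction
      (fun e => forall y y', app (e 1) (e 0) y -> app (e 2) (e 0) y' -> y = y')
      ltac:(definability) (scons f (scons f' (fun _ => t)))); cbn.
    intros x _ IH y y' Hy Hy'.
    destruct (classic (atom x)) as [Hx|Hx].
    - exact (fun_unique _ _ _ _ _ _ Hpi (Hat x y Hy Hx) (Hat' x y' Hy' Hx)).
    - apply (ext_unique _ _ _ (Hset x y Hy Hx)).
      apply (ext_iff _ _ _ (Hset' x y' Hy' Hx)); intros w.
      split; intros [v [Hv Hw]]; exists v; (split; [exact Hv|]).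
      + destruct (Htot v (Htt x v (dom _ _ Hy) Hv)) as [w' [Hw' _]].
        now rewrite <- (IH v Hv w' w Hw' Hw).
      + destruct (Htot' v (Htt' x v (dom' _ _ Hy') Hv)) as [w' [Hw' _]].
        now rewrite (IH v Hv w w' Hw Hw'). }
  intros x y y' Hy Hy'; refine (key x _ y y' Hy Hy').
  apply (grounded_of_transitive x t Ht Htt); intros w; exact (Htt x w (dom _ _ Hy)).
Qed.

Lemma acts_unique A pi x y y' :
  is_fun pi A A -> acts pi x y -> acts pi x y' -> y = y'.
Proof.
  intros Hpi [t [f [Hf Hy]]] [t' [f' [Hf' Hy']]].
  exact (action_agree _ _ _ _ _ _ Hpi Hf Hf' _ _ _ Hy Hy').
Qed.

Lemma acts_atom_app pi x y : acts pi x y -> atom x -> app pi x y.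
Proof. intros [t [f [[_ [_ [_ [_ [_ [H _]]]]]] Hy]]]; auto. Qed.

Lemma acts_elem_total pi x y v : acts pi x y -> v ∈ x -> exists w, acts pi v w.
Proof.
  intros [t [f [Hf Hy]]] Hv.
  pose proof Hf as [_ [Htt [_ [Hdom [Htot _]]]]].
  destruct Hy as [p [Hp Hpf]], (Hdom p Hpf) as [x' [y' [Hx Hp']]].
  destruct (pair_inj _ _ _ _ _ Hp Hp') as [<- _].
  destruct (Htot v (Htt x v Hx Hv)) as [w [Hw _]]; exists w, t, f; auto.
Qed.

Lemma acts_set A pi x y :
  is_fun pi A A -> acts pi x y -> ~ atom x ->
  is_ext y (fun w => exists v, v ∈ x /\ acts pi v w).
Proof.
  intros Hpi Hact Hx; pose proof Hact as [t [f [Hf Hy]]].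
  pose proof Hf as [_ [Htt [_ [Hdom [Htot [_ Hset]]]]]].
  apply (ext_iff _ _ _ (Hset x y Hy Hx)); intros w.
  split; intros [v [Hv Hw]]; exists v; (split; [exact Hv|]).
  - now exists t, f.
  - destruct Hy as [p [Hp Hpf]], (Hdom p Hpf) as [x' [y' [Hxt Hp']]].
    destruct (pair_inj _ _ _ _ _ Hp Hp') as [<- _].
    destruct (Htot v (Htt x v Hxt Hv)) as [w' [Hw' _]].
    rewrite (acts_unique A pi v w w' Hpi Hw); [exact Hw'|now exists t, f].
Qed.

(** Once the elements of [x] can be moved, so can [x]: on the transitive set of
    all members of the closure of [x] that can be moved, the action is a set, and
    it is extended by one pair. *)
Lemma acts_total A pi x :
  is_atom_set A -> is_fun pi A A -> grounded x -> exists y, acts pi x y.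
Proof.
  intros HA Hpi; revert x.
  apply (grounded_induction (fun e => exists y, acts (e 1) (e 0) y)
    ltac:(definability) (scons pi (fun _ => pi))); cbn.
  intros x Hx IH.
  destruct (classic (exists y, acts pi x y)) as [H|Hnew]; [exact H|].
  assert (Huniq : forall v w w', acts pi v w -> acts pi v w' -> w = w').
  { intros v w w'; now apply (acts_unique A). }
  destruct Hx as [c [Hc [Hct [Hxc _]]]].
  destruct (separation (fun e => exists y, acts (e 1) (e 0) y)
    ltac:(definability) (scons pi (fun _ => pi)) c) as [S [HS0 HS]]; cbn in HS.
  assert (HxS : forall v, v ∈ x -> v ∈ S) by (intros v Hv; apply HS; auto).
  assert (HSt : transitive S).
  { intros v w Hv Hw; apply HS in Hv; destruct Hv as [Hv [r Hr]].
    apply HS; split; [exact (Hct v w Hv Hw)|exact (acts_elem_total _ _ _ _ Hr Hw)]. }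
  assert (HxnS : ~ x ∈ S) by (intros H; apply HS in H; tauto).
  destruct (replacement
    (fun e => exists y, acts (e 2) (e 0) y /\ is_pair (e 1) (e 0) y)
    ltac:(definability) (scons pi (fun _ => pi)) S) as [f [_ Hf]].
  { intros v p p' _ [y [Hy Hp]] [y' [Hy' Hp']].
    rewrite (Huniq v y' y Hy' Hy) in Hp'; exact (pair_unique _ _ _ _ Hp Hp'). }
  cbn in Hf.
  assert (Hy : exists y, (atom x -> app pi x y) /\
    (~ atom x -> is_ext y (fun w => exists v, v ∈ x /\ acts pi v w))).
  { destruct (classic (atom x)) as [Hat|Hat].
    - destruct (fun_value pi A A x Hpi) as [y Hy]; [now apply HA|].
      now exists y.
    - destruct (replacement (fun e => acts (e 2) (e 0) (e 1))
        ltac:(definability) (scons pi (fun _ => pi)) x) as [y Hy].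
      { intros u v v' _; apply Huniq. }
      now exists y. }
  destruct Hy as [y [Hyat Hyset]].
  destruct (adjoin S x) as [t [Ht0 Ht]], (pair_exists x y) as [pxy Hpxy].
  destruct (adjoin f pxy) as [f' [Hf0 Hf']].
  assert (Happ : forall v w, app f' v w <-> (v ∈ S /\ acts pi v w) \/ (v = x /\ w = y)).
  { intros v w; split.
    - intros [p [Hp Hpf]]; apply Hf' in Hpf; destruct Hpf as [Hpf | ->].
      + apply Hf in Hpf; destruct Hpf as [u [Hu [r [Hr Hp']]]].
        destruct (pair_inj _ _ _ _ _ Hp Hp') as [-> ->]; auto.
      + destruct (pair_inj _ _ _ _ _ Hp Hpxy) as [-> ->]; auto.
    - intros [[Hv Hw] | [-> ->]].
      + destruct (pair_exists v w) as [p Hp]; exists p; split; [exact Hp|].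
        apply Hf'; left; apply Hf; exists v; eauto.
      + exists pxy; split; [exact Hpxy|apply Hf'; auto]. }
  exists y, t, f'; split; [|apply Happ; auto].
  split; [exact Ht0|split; [|split; [exact Hf0|split; [|split; [|split]]]]].
  - intros v w Hv Hw; apply Ht; left; apply Ht in Hv.
    destruct Hv as [Hv | ->]; [exact (HSt v w Hv Hw)|auto].
  - intros p Hp; apply Hf' in Hp; destruct Hp as [Hp | ->].
    + apply Hf in Hp; destruct Hp as [u [Hu [r [_ Hp]]]].
      exists u, r; split; [apply Ht; auto|exact Hp].
    + exists x, y; split; [apply Ht; auto|exact Hpxy].
  - intros v Hv; apply Ht in Hv; destruct Hv as [Hv | ->].
    + pose proof (proj1 (HS v) Hv) as [_ [w Hw]]; exists w; split; [apply Happ; auto|].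
      intros w' Hw'; apply Happ in Hw'; destruct Hw' as [[_ Hw'] | [-> _]]; [|tauto].
      exact (Huniq v w w' Hw Hw').
    + exists y; split; [apply Happ; auto|].
      intros w' Hw'; apply Happ in Hw'; destruct Hw' as [[H _] | [_ ->]]; tauto.
  - intros v w Hvw Hv; apply Happ in Hvw; destruct Hvw as [[_ Hw] | [-> ->]]; [|auto].
    exact (acts_atom_app _ _ _ Hw Hv).
  - intros v w Hvw Hv.
    assert (Hext : is_ext w (fun r => exists u, u ∈ v /\ acts pi u r)).
    { apply Happ in Hvw; destruct Hvw as [[_ Hw] | [-> ->]]; [|auto].
      exact (acts_set A _ _ _ Hpi Hw Hv). }
    assert (HvS : forall u, u ∈ v -> u ∈ S).
    { intros u Hu; apply Happ in Hvw; destruct Hvw as [[HvS _] | [-> _]]; [|auto].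
      exact (HSt v u HvS Hu). }
    apply (ext_iff _ _ _ Hext); intros r; split; intros [u [Hu Hr]]; exists u;
      (split; [exact Hu|]).
    + apply Happ; auto.
    + apply Happ in Hr; destruct Hr as [[_ Hr] | [-> _]]; [exact Hr|].
      destruct HxnS; auto.
Qed.
(** * Moving sets by the elements of a permutation group *)

Context (A Sigma : M) (HA : is_atom_set A) (HSigma : is_perm_group A Sigma).

Lemma mem_atoms a : a ∈ A <-> atom a.
Proof. apply HA. Qed.

Lemma perm_fun s : s ∈ Sigma -> is_fun s A A.
Proof. intros Hs; destruct HSigma as [_ [H _]]; apply H, Hs. Qed.

Lemma perm_total s x : s ∈ Sigma -> grounded x -> exists y, acts s x y.
Proof. intros Hs; exact (acts_total A s x HA (perm_fun s Hs)). Qed.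

Lemma perm_unique s x y y' : s ∈ Sigma -> acts s x y -> acts s x y' -> y = y'.
Proof. intros Hs; exact (acts_unique A s x y y' (perm_fun s Hs)). Qed.

Lemma perm_set s x y :
  s ∈ Sigma -> acts s x y -> ~ atom x ->
  is_ext y (fun w => exists v, v ∈ x /\ acts s v w).
Proof. intros Hs; exact (acts_set A s x y (perm_fun s Hs)). Qed.

Lemma perm_app_atom s a b : s ∈ Sigma -> app s a b -> atom a /\ atom b.
Proof.
  intros Hs Hab; rewrite <- !mem_atoms.
  exact (fun_dom_cod _ _ _ _ _ (perm_fun s Hs) Hab).
Qed.

Lemma acts_of_app s a b : s ∈ Sigma -> app s a b -> acts s a b.
Proof.
  intros Hs Hab; pose proof (perm_app_atom _ _ _ Hs Hab) as [Ha _].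
  destruct (perm_total s a Hs (grounded_atom a Ha)) as [c Hc].
  rewrite (fun_unique _ _ _ _ _ _ (perm_fun s Hs) Hab (acts_atom_app _ _ _ Hc Ha)).
  exact Hc.
Qed.

Lemma acts_of_ext s x y :
  s ∈ Sigma -> grounded x -> ~ atom x ->
  is_ext y (fun w => exists v, v ∈ x /\ acts s v w) -> acts s x y.
Proof.
  intros Hs Hgx Hx Hy; destruct (perm_total s x Hs Hgx) as [y' Hy'].
  rewrite (ext_unique _ _ _ Hy (perm_set _ _ _ Hs Hy' Hx)); exact Hy'.
Qed.

Lemma acts_atom_iff s x y : s ∈ Sigma -> acts s x y -> (atom x <-> atom y).
Proof.
  intros Hs H; split; intros Hat.
  - apply (perm_app_atom s x y Hs), acts_atom_app; trivial.
  - apply NNPP; intros Hx; now destruct (perm_set _ _ _ Hs H Hx).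
Qed.

Lemma acts_grounded s x y : s ∈ Sigma -> acts s x y -> grounded x -> grounded y.
Proof.
  intros Hs H Hx; revert x Hx y H.
  apply (grounded_induction
    (fun e => forall y, acts (e 1) (e 0) y -> exists t, is_transitive_closure t y)
    ltac:(definability) (scons s (fun _ => s))); cbn.
  intros x _ IH y Hy; destruct (classic (atom x)) as [Hx|Hx].
  - apply grounded_atom; now apply (acts_atom_iff s x y).
  - apply grounded_intro; intros w Hw.
    apply (perm_set _ _ _ Hs Hy Hx) in Hw; destruct Hw as [v [Hv Hw]].
    exact (IH v Hv w Hw).
Qed.

Lemma acts_identity i x : i ∈ Sigma -> is_identity A i -> grounded x -> acts i x x.
Proof.
  intros Hi Hid; revert x.
  apply (grounded_induction (fun e => acts (e 1) (e 0) (e 0))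
    ltac:(definability) (scons i (fun _ => i))); cbn.
  intros x Hgx IH; destruct (classic (atom x)) as [Hx|Hx].
  - apply acts_of_app; trivial; destruct (pair_exists x x) as [p Hp].
    exists p; split; trivial; apply Hid; exists x; now rewrite mem_atoms.
  - apply acts_of_ext; trivial; split; trivial; intros w; split.
    + intros Hw; exists w; auto.
    + intros [v [Hv Hw]].
      now rewrite (perm_unique i v w v Hi Hw (IH v Hv)).
Qed.

Lemma acts_comp h g f x y z :
  h ∈ Sigma -> g ∈ Sigma -> f ∈ Sigma -> is_comp h g f -> grounded x ->
  acts f x y -> acts g y z -> acts h x z.
Proof.
  intros Hh Hg Hf Hc Hx; revert x Hx y z.
  apply (grounded_induction
    (fun e => forall y z, acts (e 3) (e 0) y -> acts (e 2) y z -> acts (e 1) (e 0) z)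
    ltac:(definability) (scons h (scons g (scons f (fun _ => f))))); cbn.
  intros x Hgx IH y z Hy Hz.
  pose proof (acts_atom_iff _ _ _ Hf Hy) as Hxy.
  destruct (classic (atom x)) as [Hx|Hx].
  - apply acts_of_app; trivial; destruct (pair_exists x z) as [p Hp].
    exists p; split; trivial; apply Hc; exists x, y, z.
    split; [exact Hp|split]; apply acts_atom_app; tauto.
  - apply acts_of_ext; trivial.
    assert (Hny : ~ atom y) by tauto.
    apply (ext_iff _ _ _ (perm_set _ _ _ Hg Hz Hny)); intros w; split.
    + intros [v [Hv Hw]]; apply (perm_set _ _ _ Hf Hy Hx) in Hv.
      destruct Hv as [u [Hu Huv]]; exists u; eauto.
    + intros [u [Hu Huw]].
      destruct (acts_elem_total _ _ _ _ Hy Hu) as [v Hv].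
      assert (Hvy : v ∈ y) by (apply (perm_set _ _ _ Hf Hy Hx); eauto).
      destruct (acts_elem_total _ _ _ _ Hz Hvy) as [w' Hw'].
      exists v; split; trivial.
      now rewrite (perm_unique h u w w' Hh Huw (IH u Hu v w' Hv Hw')).
Qed.

Lemma acts_inverse g f x y :
  g ∈ Sigma -> f ∈ Sigma -> is_inverse g f -> grounded x ->
  acts f x y -> acts g y x.
Proof.
  intros Hg Hf Hinv Hx; revert x Hx y.
  apply (grounded_induction
    (fun e => forall y, acts (e 2) (e 0) y -> acts (e 1) y (e 0))
    ltac:(definability) (scons g (scons f (fun _ => f)))); cbn.
  intros x Hgx IH y Hy.
  pose proof (acts_atom_iff _ _ _ Hf Hy) as Hxy.
  destruct (classic (atom x)) as [Hx|Hx].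
  - apply acts_of_app; trivial; destruct (pair_exists y x) as [p Hp].
    exists p; split; trivial; apply Hinv; exists x, y.
    split; [exact Hp|now apply acts_atom_app].
  - apply acts_of_ext; [trivial|now apply (acts_grounded f x y)|tauto|].
    split; [trivial|]; intros w; split.
    + intros Hw; destruct (acts_elem_total _ _ _ _ Hy Hw) as [v Hv].
      exists v; split; [apply (perm_set _ _ _ Hf Hy Hx); eauto|auto].
    + intros [v [Hv Hw]]; apply (perm_set _ _ _ Hf Hy Hx) in Hv.
      destruct Hv as [u [Hu Huv]].
      now rewrite (perm_unique g v w u Hg Hw (IH u Hu v Huv)).
Qed.

Lemma perm_inverse s : s ∈ Sigma -> exists r, is_inverse r s /\ r ∈ Sigma.
Proof. apply HSigma. Qed.

Lemma inverse_sym r s : s ∈ Sigma -> r ∈ Sigma -> is_inverse r s -> is_inverse s r.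
Proof.
  intros Hs Hr Hinv.
  assert (Happ : forall x y, app r y x <-> app s x y).
  { intros x y; destruct (pair_exists y x) as [p Hp].
    rewrite (app_pair _ _ _ _ Hp); split.
    - intros H; apply Hinv in H; destruct H as [x' [y' [Hp' H]]].
      now destruct (pair_inj _ _ _ _ _ Hp Hp') as [-> ->].
    - intros H; apply Hinv; eauto. }
  pose proof (perm_fun s Hs) as [Hs0 [_ [_ [Hpairs _]]]].
  split; [exact Hs0|]; intros p; split.
  - intros Hp; destruct (Hpairs p Hp) as [x [y [_ [_ Hxy]]]].
    exists y, x; split; [exact Hxy|]; apply Happ; now exists p.
  - intros [y [x [Hp H]]]; apply Happ in H; now apply (app_pair _ _ _ _ Hp) in H.
Qed.

Lemma acts_inj s x x' y :
  s ∈ Sigma -> grounded x -> grounded x' -> acts s x y -> acts s x' y -> x = x'.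
Proof.
  intros Hs Hx Hx' H H'; destruct (perm_inverse s Hs) as [r [Hinv Hr]].
  apply (perm_unique r y x x' Hr); now apply (acts_inverse r s).
Qed.

Lemma acts_surj s y : s ∈ Sigma -> grounded y -> exists x, grounded x /\ acts s x y.
Proof.
  intros Hs Hy; destruct (perm_inverse s Hs) as [r [Hinv Hr]].
  destruct (perm_total r y Hr Hy) as [x Hx]; exists x; split.
  - now apply (acts_grounded r y x).
  - apply (acts_inverse s r y x); trivial; now apply inverse_sym.
Qed.

Lemma acts_mem s u v x y :
  s ∈ Sigma -> grounded u -> grounded x -> acts s u v -> acts s x y ->
  (u ∈ x <-> v ∈ y).
Proof.
  intros Hs Hu Hx Huv Hxy; pose proof (acts_atom_iff _ _ _ Hs Hxy) as Hat; split.
  - intros H; apply (perm_set _ _ _ Hs Hxy (not_atom_of_mem _ _ H)); eauto.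
  - intros H; assert (Hnx : ~ atom x) by (rewrite Hat; exact (not_atom_of_mem _ _ H)).
    apply (perm_set _ _ _ Hs Hxy Hnx) in H; destruct H as [u' [Hu' H]].
    now rewrite (acts_inj s u u' v Hs Hu (grounded_elem _ _ Hx Hu') Huv H).
Qed.

Lemma acts_upair s z x y z' x' y' :
  s ∈ Sigma -> grounded x -> grounded y -> is_upair z x y -> is_upair z' x' y' ->
  acts s x x' -> acts s y y' -> acts s z z'.
Proof.
  intros Hs Hx Hy [Hz0 Hz] [Hz0' Hz'] Hxx Hyy.
  apply acts_of_ext; trivial.
  - apply grounded_intro; intros w Hw; apply Hz in Hw; destruct Hw as [-> | ->]; trivial.
  - split; trivial; intros w; rewrite Hz'; split.
    + intros [-> | ->]; [exists x | exists y]; (split; [apply Hz|]; auto).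
    + intros [v [Hv Hw]]; apply Hz in Hv; destruct Hv as [-> | ->].
      * left; now apply (perm_unique s x).
      * right; now apply (perm_unique s y).
Qed.

Lemma acts_pair s p x y p' x' y' :
  s ∈ Sigma -> grounded x -> grounded y -> is_pair p x y -> is_pair p' x' y' ->
  acts s x x' -> acts s y y' -> acts s p p'.
Proof.
  intros Hs Hx Hy [a [b [Ha [Hb Hp]]]] [a' [b' [Ha' [Hb' Hp']]]] Hxx Hyy.
  assert (Hg : forall r q, is_upair r x q -> q = x \/ q = y -> grounded r).
  { intros r q [_ Hr] Hq; apply grounded_intro; intros w Hw; apply Hr in Hw.
    destruct Hw as [-> | ->]; [|destruct Hq as [-> | ->]]; trivial. }
  apply (acts_upair s p a b p' a' b'); trivial; try solve [eapply Hg; eauto].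
  - now apply (acts_upair s a x x a' x' x').
  - now apply (acts_upair s b x y b' x' y').
Qed.

Lemma acts_pair_inv s p x y p' :
  s ∈ Sigma -> grounded p -> is_pair p x y -> acts s p p' ->
  exists x' y', acts s x x' /\ acts s y y' /\ is_pair p' x' y'.
Proof.
  intros Hs Hg Hp Hact; destruct (grounded_pair_inv _ _ _ Hg Hp) as [Hx Hy].
  destruct (perm_total s x Hs Hx) as [x' Hx'], (perm_total s y Hs Hy) as [y' Hy'].
  destruct (pair_exists x' y') as [q Hq]; exists x', y'; split; [|split]; trivial.
  now rewrite (perm_unique s p p' q Hs Hact (acts_pair s p x y q x' y' Hs Hx Hy Hp Hq Hx' Hy')).
Qed.

Lemma acts_app s f f' x x' y y' :
  s ∈ Sigma -> grounded f -> grounded x -> grounded y ->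
  acts s f f' -> acts s x x' -> acts s y y' -> (app f x y <-> app f' x' y').
Proof.
  intros Hs Hf Hx Hy Hff Hxx Hyy.
  destruct (pair_exists x y) as [p Hp], (pair_exists x' y') as [p' Hp'].
  rewrite (app_pair _ _ _ _ Hp), (app_pair _ _ _ _ Hp').
  apply (acts_mem s); trivial.
  - exact (grounded_pair p x y Hx Hy Hp).
  - now apply (acts_pair s p x y p' x' y').
Qed.

Lemma perm_grounded s : s ∈ Sigma -> grounded s.
Proof.
  intros Hs; destruct (perm_fun s Hs) as [_ [_ [_ [Hp _]]]].
  apply grounded_intro; intros p Hps; destruct (Hp p Hps) as [x [y [Hx [Hy Hxy]]]].
  apply (grounded_pair p x y); trivial; apply grounded_atom; now apply mem_atoms.
Qed.

(** A permutation that commutes with [s], in the sense that it fixes the set [s],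
    commutes with the action of [s] on all sets. *)
Lemma acts_commute t s x y x' y' :
  t ∈ Sigma -> s ∈ Sigma -> acts t s s -> grounded x ->
  acts s x y -> acts t x x' -> acts t y y' -> acts s x' y'.
Proof.
  intros Ht Hs Hts Hx; revert x Hx y x' y'.
  apply (grounded_induction
    (fun e => forall y x' y', acts (e 1) (e 0) y -> acts (e 2) (e 0) x' ->
       acts (e 2) y y' -> acts (e 1) x' y')
    ltac:(definability) (scons s (scons t (fun _ => s)))); cbn.
  intros x Hgx IH y x' y' Hy Hx' Hy'.
  pose proof (acts_grounded s x y Hs Hy Hgx) as Hgy.
  pose proof (acts_atom_iff _ _ _ Hs Hy) as Hat.
  pose proof (acts_atom_iff _ _ _ Ht Hx') as Hat'.
  destruct (classic (atom x)) as [Hx|Hx].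
  - apply acts_of_app; trivial.
    apply (acts_app t s s x x' y y'); trivial; [now apply perm_grounded|].
    now apply acts_atom_app.
  - apply acts_of_ext; [trivial|now apply (acts_grounded t x x')|tauto|].
    assert (Hny : ~ atom y) by tauto.
    apply (ext_iff _ _ _ (perm_set _ _ _ Ht Hy' Hny)); intros w; split.
    + intros [r [Hr Hrw]]; apply (perm_set _ _ _ Hs Hy Hx) in Hr.
      destruct Hr as [v [Hv Hvr]], (acts_elem_total _ _ _ _ Hx' Hv) as [u Hu].
      exists u; split; [apply (perm_set _ _ _ Ht Hx' Hx); eauto|eauto].
    + intros [u [Hu Huw]]; apply (perm_set _ _ _ Ht Hx' Hx) in Hu.
      destruct Hu as [v [Hv Hvu]], (acts_elem_total _ _ _ _ Hy Hv) as [r Hr].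
      assert (Hry : r ∈ y) by (apply (perm_set _ _ _ Hs Hy Hx); eauto).
      destruct (acts_elem_total _ _ _ _ Hy' Hry) as [w' Hw'].
      exists r; split; trivial.
      now rewrite (perm_unique s u w w' Hs Huw (IH v Hv r u w' Hr Hvu Hw')).
Qed.
(** * Symmetric sets *)

Context (F : M) (HF : is_normal_filter A Sigma F).

(** The filter is read as a basis of neighbourhoods of the identity: [P] holds
    for all permutations close to the identity. *)
Definition holds_near (P : M -> Prop) : Prop :=
  exists Psi, Psi ∈ F /\ forall s, s ∈ Psi -> s ∈ Sigma /\ P s.

Lemma holds_near_and (P Q : M -> Prop) :
  holds_near P -> holds_near Q -> holds_near (fun s => P s /\ Q s).
Proof.
  intros [Psi [HPsi HP]] [Phi [HPhi HQ]].
  destruct HF as [_ [_ [_ [_ [Hcap _]]]]].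
  destruct (Hcap Psi Phi HPsi HPhi) as [Theta [[_ HT] HThF]].
  exists Theta; split; trivial; intros s Hs; apply HT in Hs; destruct Hs as [H1 H2].
  pose proof (HP s H1); pose proof (HQ s H2); tauto.
Qed.

Lemma holds_near_impl (P Q : M -> Prop) :
  holds_near P -> (forall s, s ∈ Sigma -> P s -> Q s) -> holds_near Q.
Proof.
  intros [Psi [HPsi HP]] HPQ; exists Psi; split; trivial; intros s Hs.
  destruct (HP s Hs); auto.
Qed.

Lemma holds_near_of_forall (P : M -> Prop) :
  (forall s, s ∈ Sigma -> P s) -> holds_near P.
Proof. intros H; exists Sigma; split; [apply HF|auto]. Qed.

Lemma symmetric_near x : symmetric Sigma F x -> holds_near (fun s => acts s x x).
Proof.
  intros [T [[_ HT] HTF]]; exists T; split; trivial; intros s Hs; now apply HT.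
Qed.

Lemma perm_comp h g f : g ∈ Sigma -> f ∈ Sigma -> is_comp h g f -> h ∈ Sigma.
Proof.
  intros Hg Hf Hc; destruct HSigma as [_ [_ [_ [H _]]]].
  destruct (H g f Hg Hf) as [h' [Hc' Hh]].
  now rewrite (ext_unique _ _ _ Hc Hc').
Qed.

Lemma stab_subgroup T x : grounded x -> is_stab Sigma T x -> is_subgroup A T Sigma.
Proof.
  intros Hx [HT0 HT]; split; [|intros s Hs; now apply HT].
  destruct HSigma as [_ [Hbij [[i [Hid Hi]] [Hcomp Hinv]]]].
  split; [exact HT0|split; [|split; [|split]]].
  - intros f Hf; now apply Hbij, HT.
  - exists i; split; trivial; apply HT; split; trivial; now apply acts_identity.
  - intros g f Hg Hf; apply HT in Hg; apply HT in Hf.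
    destruct Hg as [Hg Hgx], Hf as [Hf Hfx], (Hcomp g f Hg Hf) as [h [Hc Hh]].
    exists h; split; trivial; apply HT; split; trivial.
    now apply (acts_comp h g f x x x).
  - intros f Hf; apply HT in Hf; destruct Hf as [Hf Hfx].
    destruct (Hinv f Hf) as [g [Hg HgS]]; exists g; split; trivial.
    apply HT; split; trivial; now apply (acts_inverse g f).
Qed.

Lemma symmetric_intro x :
  grounded x -> holds_near (fun s => acts s x x) -> symmetric Sigma F x.
Proof.
  intros Hx [Psi [HPsi H]].
  destruct (separation (fun e => acts (e 0) (e 1) (e 1)) ltac:(definability)
    (scons x (fun _ => x)) Sigma) as [T HT]; cbn in HT.
  exists T; split; [exact HT|].
  destruct HF as [_ [_ [_ [Hup _]]]]; apply (Hup Psi T HPsi).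
  - exact (stab_subgroup T x Hx HT).
  - intros s Hs; apply HT; auto.
Qed.

(** Normality of the filter: the stabilizer of the image under [s] contains the
    conjugate by [s] of the stabilizer. *)
Lemma symmetric_image s x y :
  s ∈ Sigma -> grounded x -> acts s x y -> symmetric Sigma F x ->
  symmetric Sigma F y.
Proof.
  intros Hs Hx Hxy [T [[_ HT] HTF]].
  pose proof (acts_grounded _ _ _ Hs Hxy Hx) as Hy.
  apply symmetric_intro; trivial.
  destruct HF as [_ [_ [Hsub [_ [_ [Hconj _]]]]]].
  destruct (Hconj T s HTF Hs) as [Theta [[_ HTh] HThF]].
  exists Theta; split; trivial; intros t Ht.
  assert (HtS : t ∈ Sigma) by (apply (Hsub Theta HThF), Ht).
  split; trivial; apply HTh in Ht.
  destruct Ht as [psi [rho [u [Hpsi [Hrho [Hu Ht]]]]]].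
  apply HT in Hpsi; destruct Hpsi as [Hpsi Hpx].
  assert (HuS : u ∈ Sigma) by now apply (perm_comp u s psi).
  assert (HrS : rho ∈ Sigma).
  { destruct (perm_inverse s Hs) as [r [Hr HrS]].
    now rewrite (ext_unique _ _ _ Hrho Hr). }
  apply (acts_comp t u rho y x y); trivial.
  - now apply (acts_inverse rho s).
  - now apply (acts_comp u s psi x x y).
Qed.

Local Notation HS := (hereditarily_symmetric Sigma F).

Lemma hs_grounded x : HS x -> grounded x.
Proof. intros [_ [t [Ht _]]]; now exists t. Qed.

Lemma hs_near x : HS x -> holds_near (fun s => acts s x x).
Proof. intros [H _]; now apply symmetric_near. Qed.

Lemma hs_elem x y : HS x -> y ∈ x -> HS y.
Proof.
  intros Hx Hy; destruct (grounded_elem _ _ (hs_grounded x Hx) Hy) as [c Hc].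
  destruct Hx as [_ [t [[Ht0 [Htt [Hxt _]]] Hsym]]].
  split; [auto|]; exists c; split; trivial; intros w Hw; apply Hsym.
  destruct Hc as [_ [_ [_ Hmin]]]; refine (Hmin t Ht0 Htt _ w Hw).
  intros v; exact (Htt y v (Hxt y Hy)).
Qed.

(** The hereditarily symmetric sets in the closure of [x] form a transitive set
    that includes [x], hence they are the whole closure. *)
Lemma hs_intro x : symmetric Sigma F x -> (forall y, y ∈ x -> HS y) -> HS x.
Proof.
  intros Hx Hel; split; trivial.
  destruct (grounded_intro x (fun y Hy => hs_grounded y (Hel y Hy))) as [t Ht].
  exists t; split; trivial.
  (* Separation by hereditary symmetry, unfolded to make definability visible;
     the parameters [Sigma] and [F] are variables 1 and 2. *)
  destruct (separation (fun e => symmetric (e 1) (e 2) (e 0) /\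
      exists c, is_transitive_closure c (e 0) /\
        forall y, y ∈ c -> symmetric (e 1) (e 2) y) ltac:(definability)
    (scons Sigma (scons F (fun _ => x))) t) as [D [HD0 HD]]; cbn in HD.
  change (forall w, w ∈ D <-> w ∈ t /\ hereditarily_symmetric Sigma F w) in HD.
  destruct Ht as [_ [Htt [Hxt Hmin]]].
  intros y Hy; apply (Hmin D HD0) in Hy.
  - apply HD in Hy; apply Hy.
  - intros u v Hu Hv; apply HD in Hu; apply HD; destruct Hu as [Hut Hu]; split.
    + exact (Htt u v Hut Hv).
    + exact (hs_elem u v Hu Hv).
  - intros u Hu; apply HD; auto.
Qed.

Lemma hs_atom a : atom a -> HS a.
Proof.
  intros Ha; apply hs_intro.
  - destruct HF as [_ [_ [_ [_ [_ [_ H]]]]]]; apply H; now apply mem_atoms.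
  - intros y Hy; now destruct (not_atom_of_mem _ _ Hy).
Qed.

(** A member of the filter is closed under inverses, so mapping [x] into itself
    already amounts to fixing it. *)
Lemma hs_set x :
  ~ atom x -> (forall v, v ∈ x -> HS v) ->
  holds_near (fun s => forall v w, v ∈ x -> acts s v w -> w ∈ x) -> HS x.
Proof.
  intros Hx Hel Hnear.
  assert (Hg : grounded x) by (apply grounded_intro; intros; now apply hs_grounded, Hel).
  apply hs_intro; trivial; apply symmetric_intro; trivial.
  destruct Hnear as [Psi [HPsi H]]; exists Psi; split; trivial; intros s Hs.
  destruct (H s Hs) as [HsS Hsx]; split; trivial.
  apply acts_of_ext; trivial; split; trivial; intros w; split.
  - intros Hw; destruct HF as [_ [_ [Hsub _]]].
    destruct (Hsub Psi HPsi) as [[_ [_ [_ [_ Hinv]]]] _].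
    destruct (Hinv s Hs) as [r [Hr HrPsi]], (H r HrPsi) as [HrS Hrx].
    destruct (perm_total r w HrS (grounded_elem _ _ Hg Hw)) as [v Hv].
    exists v; split; [eauto|].
    apply (acts_inverse s r w v); trivial; [now apply inverse_sym|].
    exact (grounded_elem _ _ Hg Hw).
  - intros [v [Hv Hw]]; eauto.
Qed.

Lemma hs_upair z x y : is_upair z x y -> HS x -> HS y -> HS z.
Proof.
  intros [Hz0 Hz] Hx Hy; apply hs_set; trivial.
  - intros v Hv; apply Hz in Hv; destruct Hv as [-> | ->]; trivial.
  - apply (holds_near_impl _ _ (holds_near_and _ _ (hs_near x Hx) (hs_near y Hy))).
    intros s Hs [Hsx Hsy] v w Hv Hw; apply Hz; apply Hz in Hv.
    destruct Hv as [-> | ->]; [left | right]; eapply perm_unique; eauto.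
Qed.

Lemma hs_pair p x y : is_pair p x y -> HS x -> HS y -> HS p.
Proof.
  intros [s [u [Hs [Hu Hp]]]] Hx Hy.
  apply (hs_upair p s u Hp); [exact (hs_upair s x x Hs Hx Hx)|exact (hs_upair u x y Hu Hx Hy)].
Qed.

Lemma hs_pair_inv p x y : HS p -> is_pair p x y -> HS x /\ HS y.
Proof.
  intros HSp [s [u [_ [[_ Hu] [_ Hp]]]]].
  assert (Hsu : HS u) by (apply (hs_elem p); [exact HSp|apply Hp; auto]).
  split; apply (hs_elem u); trivial; apply Hu; auto.
Qed.
(** * The permutation model *)

Local Notation N := (permutation_model Sigma F).

Definition val (x : N) : M := proj1_sig x.

Lemma val_hs (x : N) : HS (val x).
Proof. exact (proj2_sig x). Qed.

Lemma val_grounded (x : N) : grounded (val x).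
Proof. exact (hs_grounded _ (val_hs x)). Qed.

Lemma val_inj (x y : N) : val x = val y -> x = y.
Proof.
  destruct x as [x Hx], y as [y Hy]; cbn; intros <-.
  now rewrite (proof_irrelevance _ Hx Hy).
Qed.

Lemma val_surj x : HS x -> exists x' : N, val x' = x.
Proof. intros Hx; now exists (exist _ x Hx). Qed.

Lemma val_elem (x : N) y : y ∈ val x -> exists y' : N, val y' = y.
Proof. intros Hy; apply val_surj; exact (hs_elem _ _ (val_hs x) Hy). Qed.

Lemma model_extensionality (x y : N) :
  ~ atom x -> ~ atom y -> (forall w : N, w ∈ x <-> w ∈ y) -> x = y.
Proof.
  intros Hx Hy H; apply val_inj, (zfa_extensionality HM Hx Hy); intros w; split.
  - intros Hw; destruct (val_elem x w Hw) as [w' <-]; now apply (H w').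
  - intros Hw; destruct (val_elem y w Hw) as [w' <-]; now apply (H w').
Qed.

Lemma upair_absolute (z x y : N) :
  is_upair z x y <-> is_upair (val z) (val x) (val y).
Proof.
  split; intros [Hz0 Hz]; (split; [exact Hz0|]).
  - intros w; split.
    + intros Hw; destruct (val_elem z w Hw) as [w' <-].
      apply (Hz w') in Hw; destruct Hw as [-> | ->]; auto.
    + intros [-> | ->]; apply Hz; auto.
  - intros w; change (w ∈ z) with (val w ∈ val z); rewrite Hz.
    split; (intros [H|H]; [left|right]); [apply val_inj|apply val_inj| |]; congruence.
Qed.

Lemma pair_absolute (p x y : N) :
  is_pair p x y <-> is_pair (val p) (val x) (val y).
Proof.
  split; intros [s [u [Hs [Hu Hp]]]].
  - exists (val s), (val u); now rewrite <- !upair_absolute.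
  - destruct (val_surj s (hs_upair _ _ _ Hs (val_hs x) (val_hs x))) as [s' <-].
    destruct (val_surj u (hs_upair _ _ _ Hu (val_hs x) (val_hs y))) as [u' <-].
    exists s', u'; now rewrite !upair_absolute.
Qed.

Lemma model_pair_exists (x y : N) : exists p : N, is_pair p x y.
Proof.
  destruct (pair_exists (val x) (val y)) as [p Hp].
  destruct (val_surj p (hs_pair _ _ _ Hp (val_hs x) (val_hs y))) as [p' <-].
  exists p'; now apply pair_absolute.
Qed.

Lemma model_pair_inj (p x y x' y' : N) :
  is_pair p x y -> is_pair p x' y' -> x = x' /\ y = y'.
Proof.
  rewrite !pair_absolute; intros H H'.
  destruct (pair_inj _ _ _ _ _ H H'); split; now apply val_inj.
Qed.

Lemma app_absolute (f x y : N) : app f x y <-> app (val f) (val x) (val y).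
Proof.
  split; intros [p [Hp Hpf]].
  - exists (val p); now rewrite <- pair_absolute.
  - destruct (val_elem f p Hpf) as [p' <-].
    exists p'; now rewrite pair_absolute.
Qed.

Lemma app_lift (f : N) x y :
  app (val f) x y -> exists x' y' : N, val x' = x /\ val y' = y /\ app f x' y'.
Proof.
  intros [p [Hp Hpf]].
  destruct (hs_pair_inv p x y (hs_elem _ _ (val_hs f) Hpf) Hp) as [Hx Hy].
  destruct (val_surj x Hx) as [x' <-], (val_surj y Hy) as [y' <-].
  exists x', y'; split; [|split]; trivial; apply app_absolute; now exists p.
Qed.

(** The elements of [Sigma] fixing the set [f] are automorphisms of the relation
    that [f] codes. *)
Lemma acts_model_app s (f x x' y y' : N) :
  s ∈ Sigma -> acts s (val f) (val f) -> acts s (val x) (val x') ->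
  acts s (val y) (val y') -> (app f x y <-> app f x' y').
Proof.
  intros Hs Hf Hx Hy; rewrite !app_absolute.
  apply (acts_app s); trivial; apply val_grounded.
Qed.

(** If [s] fixes the function [f], then [f (s[x]) = s[f x]].  The value [s[f x]] is
    in the model as a component of an element of [f]. *)
Lemma model_image s (f x y : N) x' :
  s ∈ Sigma -> acts s (val f) (val f) -> app f x y -> acts s (val x) x' ->
  exists y' z : N, val z = x' /\ acts s (val y) (val y') /\ app f z y'.
Proof.
  intros Hs Hf Hxy Hx.
  destruct (perm_total s (val y) Hs (val_grounded y)) as [y' Hy].
  destruct (app_lift f x' y') as [z [r [<- [<- H]]]]; [|now exists r, z].
  apply (acts_app s (val f) (val f) (val x) x' (val y) y'); trivial;
    try apply val_grounded; now apply app_absolute.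
Qed.

Lemma model_product_exists (X Y : N) : exists Q : N, is_prod Q X Y.
Proof.
  destruct (product_exists (val X) (val Y)) as [Q [HQ0 HQ]].
  assert (HSQ : HS Q).
  { apply hs_set; trivial.
    - intros p Hp; apply HQ in Hp; destruct Hp as [x [y [Hx [Hy Hp]]]].
      apply (hs_pair p x y Hp); eapply hs_elem; eauto using val_hs.
    - apply (holds_near_impl _ _ (holds_near_and _ _ (hs_near _ (val_hs X))
        (hs_near _ (val_hs Y)))).
      intros s Hs [HX HY] p q Hp Hpq; apply HQ in Hp.
      destruct Hp as [x [y [Hx [Hy Hp]]]].
      assert (Hgx := grounded_elem _ _ (val_grounded X) Hx).
      assert (Hgy := grounded_elem _ _ (val_grounded Y) Hy).
      destruct (acts_pair_inv s p x y q Hs (grounded_pair p x y Hgx Hgy Hp) Hp Hpq)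
        as [x' [y' [Hxx [Hyy Hq]]]].
      apply HQ; exists x', y'; split; [|split; [|exact Hq]].
      + now apply (acts_mem s x x' (val X) (val X) Hs Hgx (val_grounded X)).
      + now apply (acts_mem s y y' (val Y) (val Y) Hs Hgy (val_grounded Y)). }
  destruct (val_surj Q HSQ) as [Q' <-]; exists Q'; split; [exact HQ0|].
  intros p; split.
  - intros Hp; apply HQ in Hp; destruct Hp as [x [y [Hx [Hy Hp]]]].
    destruct (val_elem X x Hx) as [x' <-], (val_elem Y y Hy) as [y' <-].
    exists x', y'; split; [|split]; trivial; now apply pair_absolute.
  - intros [x [y [Hx [Hy Hp]]]]; apply HQ; exists (val x), (val y).
    split; [|split]; trivial; now apply pair_absolute.
Qed.

(** * The group of symmetric sets of atoms *)

(** The set of symmetric subsets of [A] is invariant under all of [Sigma], by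
    normality of the filter. *)
Lemma symmetric_subsets_exists :
  exists X : N, ~ atom X /\
    forall x : N, x ∈ X <-> ~ atom x /\ forall w : N, w ∈ x -> atom w.
Proof.
  destruct (zfa_power HM A) as [PA [_ HPA]].
  destruct (separation (fun e => symmetric (e 1) (e 2) (e 0)) ltac:(definability)
    (scons Sigma (scons F (fun _ => A))) PA) as [X [HX0 HX]]; cbn in HX.
  assert (HXA : forall x, x ∈ X -> symmetric Sigma F x /\ ~ atom x /\ subset x A).
  { intros x Hx; apply HX in Hx; destruct Hx as [Hx Hsym]; apply HPA in Hx; tauto. }
  assert (HSX : HS X).
  { apply hs_set; trivial.
    - intros x Hx; apply HXA in Hx; apply hs_intro; [apply Hx|].
      intros y Hy; apply hs_atom, mem_atoms, Hx, Hy.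
    - apply holds_near_of_forall; intros s Hs x y Hx Hxy.
      apply HXA in Hx; destruct Hx as [Hsym [Hx HxA]].
      assert (Hg : grounded x).
      { apply grounded_intro; intros w Hw; apply grounded_atom, mem_atoms, HxA, Hw. }
      apply HX; split; [|now apply (symmetric_image s x)].
      destruct (perm_set s x y Hs Hxy Hx) as [Hy0 Hy].
      apply HPA; split; trivial; intros w Hw; apply Hy in Hw.
      destruct Hw as [v [Hv Hw]]; apply mem_atoms, (acts_atom_iff s v w Hs Hw).
      apply mem_atoms; auto. }
  destruct (val_surj X HSX) as [X' <-]; exists X'.
  split; [exact HX0|].
  intros x; split.
  - intros Hx; apply HXA in Hx; destruct Hx as [_ [Hx HxA]]; split; trivial.
    intros w Hw; apply mem_atoms, HxA, Hw.
  - intros [Hx0 Hx]; apply HX; split; [|apply val_hs]; apply HPA; split; trivial.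
    intros w Hw; destruct (val_elem x w Hw) as [w' <-]; apply mem_atoms; now apply Hx.
Qed.

(** Stated over any structure, for use both in the model and in the structure
    around it. *)
Definition is_symdiff {T : structure} (z x y : T) : Prop :=
  is_ext z (fun w : T => (w ∈ x /\ ~ w ∈ y) \/ (~ w ∈ x /\ w ∈ y)).

Lemma symdiff_absolute (z x y : N) :
  is_symdiff z x y <-> is_symdiff (val z) (val x) (val y).
Proof.
  split; intros [Hz0 Hz]; (split; [exact Hz0|]); [|intros w; apply Hz].
  intros w; split.
  - intros Hw; destruct (val_elem z w Hw) as [w' <-]; now apply Hz.
  - intros Hw; assert (H : w ∈ val x \/ w ∈ val y) by tauto.
    destruct H as [H|H]; destruct (val_elem _ w H) as [w' <-]; now apply Hz.
Qed.

(** Every element of the images has a preimage under [s], and [s] respects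
    membership. *)
Lemma acts_symdiff s z x y z' x' y' :
  s ∈ Sigma -> grounded z -> grounded x -> grounded y ->
  acts s z z' -> acts s x x' -> acts s y y' ->
  is_symdiff z x y -> is_symdiff z' x' y'.
Proof.
  intros Hs Hgz Hgx Hgy Hz Hx Hy [Hz0 Hext]; split.
  { now rewrite <- (acts_atom_iff s z z'). }
  assert (mem_iff : forall v w, grounded v -> acts s v w ->
    (w ∈ z' <-> (w ∈ x' /\ ~ w ∈ y') \/ (~ w ∈ x' /\ w ∈ y'))).
  { intros v w Hv Hvw.
    rewrite <- (acts_mem s v w z z'), <- (acts_mem s v w x x'),
      <- (acts_mem s v w y y'); trivial. }
  assert (Hg : forall r r', acts s r r' -> grounded r -> forall w, w ∈ r' ->
    exists v, grounded v /\ acts s v w).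
  { intros r r' Hr Hgr w Hw; apply acts_surj; trivial.
    now apply (grounded_elem r'); [apply (acts_grounded s r r')|]. }
  intros w; split; intros Hw.
  - destruct (Hg z z' Hz Hgz w Hw) as [v [Hv Hvw]]; now apply (mem_iff v w Hv Hvw).
  - assert (H : w ∈ x' \/ w ∈ y') by tauto.
    destruct H as [H|H]; [destruct (Hg x x' Hx Hgx w H) as [v [Hv Hvw]]
      | destruct (Hg y y' Hy Hgy w H) as [v [Hv Hvw]]]; now apply (mem_iff v w Hv Hvw).
Qed.

Lemma model_symdiff_exists (x y : N) : exists z : N, is_symdiff z x y.
Proof.
  destruct (binary_union (val x) (val y)) as [U [_ HU]].
  destruct (separation
    (fun e => (e 0 ∈ e 1 /\ ~ e 0 ∈ e 2) \/ (~ e 0 ∈ e 1 /\ e 0 ∈ e 2))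
    ltac:(definability) (scons (val x) (scons (val y) (fun _ => U))) U) as [z Hz].
  cbn in Hz; assert (Hsd : is_symdiff z (val x) (val y)).
  { apply (ext_iff _ _ _ Hz); intros w; rewrite HU; tauto. }
  clear Hz.
  assert (Hel : forall w, w ∈ z -> HS w).
  { intros w Hw; apply Hsd in Hw; assert (H : w ∈ val x \/ w ∈ val y) by tauto.
    destruct H as [H|H]; exact (hs_elem _ _ (val_hs _) H). }
  assert (Hg : grounded z) by (apply grounded_intro; intros; now apply hs_grounded, Hel).
  assert (Hz : HS z).
  { apply hs_intro; trivial; apply symmetric_intro; trivial.
    apply (holds_near_impl _ _ (holds_near_and _ _ (hs_near _ (val_hs x))
      (hs_near _ (val_hs y)))).
    intros s Hs [Hx Hy]; destruct (perm_total s z Hs Hg) as [z' Hz'].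
    assert (Hsd' : is_symdiff z' (val x) (val y)).
    { apply (acts_symdiff s z (val x) (val y)); trivial; apply val_grounded. }
    rewrite (ext_unique _ _ _ Hsd' Hsd) in Hz'; exact Hz'. }
  destruct (val_surj z Hz) as [z' <-]; exists z'; now apply symdiff_absolute.
Qed.

Lemma symdiff_graph_exists (X : N) :
  exists m : N, ~ atom m /\ forall p : N, p ∈ m <->
    exists x y z q : N, x ∈ X /\ y ∈ X /\ z ∈ X /\ is_symdiff z x y /\
      is_pair q x y /\ is_pair p q z.
Proof.
  destruct (model_product_exists X X) as [Q HQ].
  destruct (model_product_exists Q X) as [QX HQX].
  destruct (separation (fun e => exists x y z q, x ∈ e 1 /\ y ∈ e 1 /\ z ∈ e 1 /\
      ~ atom z /\ (forall w, w ∈ z <-> (w ∈ x /\ ~ w ∈ y) \/ (~ w ∈ x /\ w ∈ y)) /\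
      is_pair q x y /\ is_pair (e 0) q z)
    ltac:(definability) (scons (val X) (fun _ => A)) (val QX)) as [m [Hm0 Hm]].
  cbn in Hm.
  assert (Hm' : forall p, p ∈ m <-> exists x y z q, x ∈ val X /\ y ∈ val X /\
    z ∈ val X /\ is_symdiff z x y /\ is_pair q x y /\ is_pair p q z).
  { intros p; rewrite Hm; split.
    - intros [_ [x [y [z [q H]]]]]; exists x, y, z, q; unfold is_symdiff, is_ext; tauto.
    - intros [x [y [z [q [Hx [Hy [Hz [Hsd [Hq Hp]]]]]]]]]; split.
      + destruct (val_elem X x Hx) as [x' <-], (val_elem X y Hy) as [y' <-],
          (val_elem X z Hz) as [z' <-].
        destruct (val_surj q (hs_pair _ _ _ Hq (val_hs _) (val_hs _))) as [q' <-].
        destruct (val_surj p (hs_pair _ _ _ Hp (val_hs _) (val_hs _))) as [p' <-].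
        apply HQX; exists q', z'; rewrite pair_absolute; split; [|auto].
        apply HQ; exists x', y'; rewrite pair_absolute; auto.
      + destruct Hsd as [Hz0 Hsd]; exists x, y, z, q; tauto. }
  assert (HSm : HS m).
  { apply hs_set; trivial.
    - intros p Hp; apply Hm in Hp; destruct Hp as [Hp _].
      exact (hs_elem _ _ (val_hs QX) Hp).
    - apply (holds_near_impl _ _ (hs_near _ (val_hs X))).
      intros s Hs HX p p' Hp Hpp; pose proof Hp as HpQ; apply Hm in HpQ.
      destruct HpQ as [HpQ _].
      pose proof (grounded_elem _ _ (val_grounded QX) HpQ) as Hgp.
      apply Hm' in Hp; destruct Hp as [x [y [z [q [Hx [Hy [Hz [Hsd [Hq Hp]]]]]]]]].
      destruct (grounded_pair_inv _ _ _ Hgp Hp) as [Hgq Hgz].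
      destruct (grounded_pair_inv _ _ _ Hgq Hq) as [Hgx Hgy].
      destruct (acts_pair_inv s p q z p' Hs Hgp Hp Hpp) as [q' [z' [Hqq [Hzz Hp']]]].
      destruct (acts_pair_inv s q x y q' Hs Hgq Hq Hqq) as [x' [y' [Hxx [Hyy Hq']]]].
      apply Hm'; exists x', y', z', q'.
      rewrite <- (acts_mem s x x' (val X) (val X)), <- (acts_mem s y y' (val X) (val X)),
        <- (acts_mem s z z' (val X) (val X)) by (trivial; apply val_grounded).
      repeat split; trivial;
        apply (acts_symdiff s z x y z' x' y' Hs Hgz Hgx Hgy Hzz Hxx Hyy Hsd). }
  destruct (val_surj m HSm) as [m' <-]; exists m'; split; [exact Hm0|].
  intros p; change (p ∈ m') with (val p ∈ val m'); rewrite Hm'; split.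
  - intros [x [y [z [q [Hx [Hy [Hz [Hsd [Hq Hp]]]]]]]]].
    destruct (val_elem X x Hx) as [x' <-], (val_elem X y Hy) as [y' <-],
      (val_elem X z Hz) as [z' <-].
    destruct (val_surj q (hs_pair _ _ _ Hq (val_hs _) (val_hs _))) as [q' <-].
    exists x', y', z', q'; rewrite symdiff_absolute, !pair_absolute; auto 10.
  - intros [x [y [z [q H]]]]; exists (val x), (val y), (val z), (val q).
    now rewrite symdiff_absolute, !pair_absolute in H.
Qed.

(** The neutral element is the empty set, which appears as the symmetric
    difference of [X] with itself, and every element is its own inverse. *)
Lemma symdiff_group_exists :
  exists G X m : N, is_group_with G X m /\
    (forall x : N, x ∈ X <-> ~ atom x /\ forall w : N, w ∈ x -> atom w) /\
    (forall x y z : N, op m x y z <-> x ∈ X /\ y ∈ X /\ z ∈ X /\ is_symdiff z x y).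
Proof.
  destruct symmetric_subsets_exists as [X [HX0 HX]].
  destruct (symdiff_graph_exists X) as [m [Hm0 Hm]].
  destruct (model_product_exists X X) as [Q HQ].
  destruct (model_pair_exists X m) as [G HG].
  assert (Hop : forall x y z : N,
    op m x y z <-> x ∈ X /\ y ∈ X /\ z ∈ X /\ is_symdiff z x y).
  { intros x y z; split.
    - intros [q [Hq [p [Hp Hpm]]]]; apply Hm in Hpm.
      destruct Hpm as [x' [y' [z' [q' [Hx [Hy [Hz [Hsd [Hq' Hp']]]]]]]]].
      destruct (model_pair_inj _ _ _ _ _ Hp Hp') as [<- <-].
      destruct (model_pair_inj _ _ _ _ _ Hq Hq') as [<- <-]; auto.
    - intros [Hx [Hy [Hz Hsd]]]; destruct (model_pair_exists x y) as [q Hq].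
      destruct (model_pair_exists q z) as [p Hp]; exists q; split; trivial.
      exists p; split; trivial; apply Hm; exists x, y, z, q; auto 10. }
  assert (Hclosed : forall x y z : N, x ∈ X -> y ∈ X -> is_symdiff z x y -> z ∈ X).
  { intros x y z Hx Hy Hsd; apply HX; split; [apply Hsd|].
    intros w Hw; apply Hsd in Hw; destruct Hw as [[Hw _] | [_ Hw]];
      [apply HX in Hx | apply HX in Hy]; now apply (Hx, Hy). }
  exists G, X, m; split; [|split; trivial].
  split; [exact HG|split; [|split]].
  - exists Q; split; [exact HQ|]; split; [exact Hm0|split; [apply HQ|split; [exact HX0|]]].
    split.
    + intros p Hp; apply Hm in Hp.
      destruct Hp as [x [y [z [q [Hx [Hy [Hz [Hsd [Hq Hp]]]]]]]]].
      exists q, z; split; [|split; trivial]; apply HQ; exists x, y; auto.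
    + intros q Hq; apply HQ in Hq; destruct Hq as [x [y [Hx [Hy Hq]]]].
      destruct (model_symdiff_exists x y) as [z Hz]; exists z; split.
      * assert (Hzop : op m x y z) by (apply Hop; repeat split; eauto; apply Hz).
        destruct Hzop as [q' [Hq' H]]; apply pair_absolute in Hq, Hq'.
        now rewrite (val_inj _ _ (pair_unique _ _ _ _ Hq Hq')).
      * intros z' Hz'; assert (H : op m x y z') by (now exists q).
        apply Hop in H; destruct H as [_ [_ [_ H]]].
        apply model_extensionality; [apply Hz|apply H|].
        intros w; destruct Hz as [_ Hz], H as [_ H]; now rewrite Hz, H.
  - intros x y z u v w w' Hx Hy Hz Hu Hw Hv Hw'.
    apply Hop in Hu, Hw, Hv, Hw'.
    destruct Hu as [_ [_ [_ [_ Hu]]]], Hv as [_ [_ [_ [_ Hv]]]].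
    destruct Hw as [_ [_ [_ [Hw0 Hw]]]], Hw' as [_ [_ [_ [Hw0' Hw']]]].
    apply model_extensionality; trivial; intros r; rewrite Hw, Hw', Hu, Hv.
    destruct (classic (r ∈ x)), (classic (r ∈ y)), (classic (r ∈ z)); tauto.
  - destruct (model_symdiff_exists X X) as [e [He0 He]].
    assert (Hempty : forall w : N, ~ w ∈ e) by (intros w Hw; apply He in Hw; tauto).
    assert (HeX : e ∈ X).
    { apply HX; split; trivial; intros w Hw; now destruct (Hempty w). }
    exists e; split; [exact HeX|split].
    + intros x Hx; pose proof (proj1 (proj1 (HX x) Hx)) as Hx0.
      split; apply Hop; (split; [|split; [|split; [|split]]]); trivial; intros w;
        specialize (Hempty w); tauto.
    + intros x Hx; exists x; split; trivial.
      split; apply Hop; (split; [|split; [|split; [|split]]]); trivial; intros w;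
        specialize (Hempty w); tauto.
Qed.

(** * Automorphism groups of graphs in the model *)

(** The function induced on [V] is invariant under the permutations that fix
    both [V] and the set [s]; this is why [s] has to be an internal
    automorphism. *)
Lemma induced_map_exists (s V : N) :
  ~ atom V -> val s ∈ Sigma -> acts (val s) (val V) (val V) ->
  exists f : N, ~ atom f /\
    (forall p : N, p ∈ f -> exists x y : N, is_pair p x y) /\
    forall x y : N, app f x y <-> x ∈ V /\ acts (val s) (val x) (val y).
Proof.
  intros HV0 Hs HsV; destruct (model_product_exists V V) as [Q [_ HQ]].
  destruct (separation (fun e => exists x y, is_pair (e 0) x y /\ acts (e 1) x y)
    ltac:(definability) (scons (val s) (fun _ => A)) (val Q)) as [f [Hf0 Hf]].
  cbn in Hf.
  assert (HSf : HS f).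
  { apply hs_set; trivial.
    - intros p Hp; apply Hf in Hp; exact (hs_elem _ _ (val_hs Q) (proj1 Hp)).
    - apply (holds_near_impl _ _ (holds_near_and _ _ (hs_near _ (val_hs s))
        (hs_near _ (val_hs Q)))).
      intros t Ht [Hts HtQ] p q Hp Hpq; apply Hf in Hp.
      destruct Hp as [HpQ [x [y [Hp Hxy]]]]; apply Hf.
      assert (Hgp := grounded_elem _ _ (val_grounded Q) HpQ).
      destruct (grounded_pair_inv _ _ _ Hgp Hp) as [Hgx Hgy].
      split; [now apply (acts_mem t p q (val Q) (val Q) Ht Hgp (val_grounded Q))|].
      destruct (acts_pair_inv t p x y q Ht Hgp Hp Hpq) as [x' [y' [Hx [Hy Hq]]]].
      exists x', y'; split; trivial.
      now apply (acts_commute t (val s) x y). }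
  destruct (val_surj f HSf) as [f' <-]; exists f'.
  split; [exact Hf0|split].
  - intros p Hp; apply Hf in Hp; destruct Hp as [HpQ _]; apply HQ in HpQ.
    destruct HpQ as [x [y [_ [_ Hp]]]]; now exists x, y.
  - intros x y; destruct (model_pair_exists x y) as [p Hp].
    assert (Hp' := proj1 (pair_absolute _ _ _) Hp).
    rewrite app_absolute, (app_pair _ _ _ _ Hp'), Hf; split.
    + intros [HpQ [a [b [Hab Hact]]]]; apply HQ in HpQ.
      destruct HpQ as [x' [y' [Hx [_ Hxy]]]].
      destruct (model_pair_inj _ _ _ _ _ Hp Hxy) as [<- <-].
      destruct (pair_inj _ _ _ _ _ Hp' Hab) as [<- <-]; auto.
    + intros [Hx Hact]; split; [|now exists (val x), (val y)].
      apply HQ; exists x, y; split; [|split]; trivial.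
      apply (acts_mem (val s) (val x) (val y) (val V) (val V)); trivial;
        apply val_grounded.
Qed.

Lemma induced_map_is_graph_aut (s V E f : N) :
  ~ atom V -> val s ∈ Sigma -> acts (val s) (val V) (val V) ->
  acts (val s) (val E) (val E) -> ~ atom f ->
  (forall p : N, p ∈ f -> exists x y : N, is_pair p x y) ->
  (forall x y : N, app f x y <-> x ∈ V /\ acts (val s) (val x) (val y)) ->
  is_graph_aut V E f.
Proof.
  intros HV0 Hs HsV HsE Hf0 Hfp Hf.
  assert (HV : forall x y : N, acts (val s) (val x) (val y) -> (x ∈ V <-> y ∈ V)).
  { intros x y Hxy; apply (acts_mem (val s) (val x) (val y)); trivial; apply val_grounded. }
  split; [split; [split; [exact Hf0|split; [exact HV0|split; [exact HV0|split]]]|]|].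
  - intros p Hp; destruct (Hfp p Hp) as [x [y Hxy]]; exists x, y.
    assert (H : app f x y) by now exists p.
    apply Hf in H; rewrite <- (HV x y); tauto.
  - intros x Hx; destruct (perm_total (val s) (val x) Hs (val_grounded x)) as [y Hy].
    assert (HyV : y ∈ val V).
    { apply (acts_mem (val s) (val x) y (val V) (val V)); trivial; apply val_grounded. }
    destruct (val_elem V y HyV) as [y' <-]; exists y'; split; [now apply Hf|].
    intros z Hz; apply Hf in Hz; apply val_inj.
    now apply (perm_unique (val s) (val x)).
  - intros y Hy; destruct (acts_surj (val s) (val y) Hs (val_grounded y)) as [x [Hgx Hx]].
    assert (HxV : x ∈ val V).
    { apply (acts_mem (val s) x (val y) (val V) (val V)); trivial; apply val_grounded. }
    destruct (val_elem V x HxV) as [x' <-]; exists x'; split; [now apply Hf|].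
    intros z Hz; apply Hf in Hz; apply val_inj.
    apply (acts_inj (val s) _ _ (val y)); trivial; [apply val_grounded|apply Hz].
  - intros x y x' y' Hx Hy; apply Hf in Hx, Hy.
    apply (acts_model_app (val s)); tauto.
Qed.

Lemma comp_app (h g f x z : N) :
  is_comp h g f -> (app h x z <-> exists y : N, app f x y /\ app g y z).
Proof.
  intros [_ Hh]; split.
  - intros [p [Hp Hph]]; apply Hh in Hph.
    destruct Hph as [x' [y [z' [Hp' H]]]].
    destruct (model_pair_inj _ _ _ _ _ Hp Hp') as [-> ->]; now exists y.
  - intros [y H]; destruct (model_pair_exists x z) as [p Hp].
    exists p; split; trivial; apply Hh; now exists x, y, z.
Qed.

(** The image of [y] under [s] is the conjugate of [y] by the function that [s]
    induces. *)
Lemma induced_map_conjugates (s V f y y' h h' : N) :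
  val s ∈ Sigma ->
  (forall x z : N, app f x z <-> x ∈ V /\ acts (val s) (val x) (val z)) ->
  is_fun y V V -> acts (val s) (val y) (val y') ->
  is_comp h f y -> is_comp h' y' f -> h = h'.
Proof.
  intros Hs Hf Hy Hyy Hh Hh'.
  assert (Hycod : forall x z : N, app y x z -> x ∈ V /\ z ∈ V).
  { intros x z [p [Hp Hpy]]; destruct Hy as [_ [_ [_ [H _]]]].
    destruct (H p Hpy) as [x' [z' [Hx [Hz Hp']]]].
    now destruct (model_pair_inj _ _ _ _ _ Hp Hp') as [-> ->]. }
  assert (Hiff : forall x z : N, app h x z <-> app h' x z).
  { intros x z; rewrite (comp_app _ _ _ _ _ Hh), (comp_app _ _ _ _ _ Hh'); split.
    - intros [w [Hw Hz]]; apply Hf in Hz; destruct Hz as [_ Hz].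
      destruct (perm_total (val s) (val x) Hs (val_grounded x)) as [x' Hx'].
      assert (H : app (val y') x' (val z)).
      { apply (acts_app (val s) (val y) (val y') (val x) x' (val w) (val z));
          trivial; try apply val_grounded; now apply app_absolute. }
      destruct (app_lift _ _ _ H) as [r [z' [<- [Hz' Hrz]]]].
      apply val_inj in Hz'; subst z'; exists r; split; trivial.
      apply Hf; split; [now apply (Hycod x w)|trivial].
    - intros [r [Hr Hz]]; apply Hf in Hr; destruct Hr as [HxV Hr].
      destruct (acts_surj (val s) (val z) Hs (val_grounded z)) as [w [Hgw Hw]].
      assert (H : app (val y) (val x) w).
      { apply (acts_app (val s) (val y) (val y') (val x) (val r) w (val z));
          trivial; try apply val_grounded; now apply app_absolute. }
      destruct (app_lift _ _ _ H) as [x' [w' [Hx' [<- Hxw]]]].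
      apply val_inj in Hx'; subst x'; exists w'; split; trivial.
      apply Hf; split; [now apply (Hycod x w')|trivial]. }
  apply model_extensionality; [apply Hh|apply Hh'|].
  intros p; split; intros Hp.
  - pose proof (proj1 (proj2 Hh p) Hp) as [x [w [z [Hxz _]]]].
    assert (H : app h x z) by now exists p.
    apply Hiff in H; destruct H as [q [Hq Hqh]]; apply pair_absolute in Hq, Hxz.
    now rewrite (val_inj _ _ (pair_unique _ _ _ _ Hxz Hq)).
  - pose proof (proj1 (proj2 Hh' p) Hp) as [x [w [z [Hxz _]]]].
    assert (H : app h' x z) by now exists p.
    apply Hiff in H; destruct H as [q [Hq Hqh]]; apply pair_absolute in Hq, Hxz.
    now rewrite (val_inj _ _ (pair_unique _ _ _ _ Hxz Hq)).
Qed.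

Lemma moved_atom s : s ∈ Sigma -> ~ is_identity A s ->
  exists a b : N, atom a /\ acts s (val a) (val b) /\ a <> b.
Proof.
  intros Hs Hid; apply NNPP; intros Hfix; apply Hid.
  pose proof (perm_fun s Hs) as Hfun.
  assert (Hdiag : forall x y, app s x y -> x = y).
  { intros x y Hxy; destruct (perm_app_atom s x y Hs Hxy) as [Hx Hy].
    destruct (val_surj x (hs_atom x Hx)) as [x' <-], (val_surj y (hs_atom y Hy)) as [y' <-].
    apply NNPP; intros Hne; apply Hfix; exists x', y'; split; [exact Hx|split].
    - now apply acts_of_app.
    - intros ->; now apply Hne. }
  split; [apply Hfun|]; intros p; split.
  - intros Hp; pose proof Hfun as [_ [_ [_ [Hpairs _]]]].
    destruct (Hpairs p Hp) as [x [y [Hx [_ Hxy]]]]; exists x; split; trivial.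
    rewrite (Hdiag x y) at 2; [trivial|now exists p].
  - intros [x [Hx Hp]]; destruct (fun_value s A A x Hfun Hx) as [y Hy].
    apply (app_pair s p x x Hp); now rewrite (Hdiag x y Hy) at 2.
Qed.

Lemma model_singleton_exists (a : N) : exists x : N, is_upair x a a.
Proof.
  destruct (zfa_pairing HM (val a) (val a)) as [x Hx].
  destruct (val_surj x (hs_upair _ _ _ Hx (val_hs a) (val_hs a))) as [x' <-].
  exists x'; now apply upair_absolute.
Qed.

Lemma bij_image (f X Y x : N) : is_bij f X Y -> x ∈ X -> exists y : N, app f x y.
Proof.
  intros [[_ [_ [_ [_ H]]]] _] Hx; destruct (H x Hx) as [y [Hy _]]; now exists y.
Qed.

Lemma bij_dom_cod (f X Y x y : N) : is_bij f X Y -> app f x y -> x ∈ X /\ y ∈ Y.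
Proof.
  intros [[_ [_ [_ [H _]]]] _] [p [Hp Hpf]]; destruct (H p Hpf) as [x' [y' [Hx [Hy Hp']]]].
  now destruct (model_pair_inj _ _ _ _ _ Hp Hp') as [-> ->].
Qed.

Lemma bij_inj (f X Y x x' y : N) : is_bij f X Y -> app f x y -> app f x' y -> x = x'.
Proof.
  intros Hf Hx Hx'; destruct (bij_dom_cod _ _ _ _ _ Hf Hx) as [_ Hy].
  destruct Hf as [_ H], (H y Hy) as [z [_ Hz]].
  now rewrite <- (Hz x Hx), <- (Hz x' Hx').
Qed.

(** With [u = g + {a}] and [u' = g + s[{a}]], the automorphisms [phi u] and
    [phi u'] are the two composites that [induced_map_conjugates] identifies,
    the second one because [X] is abelian.  Hence [u = u'] and [s[{a}] = {a}]. *)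
Lemma no_graph_for_symdiff_group :
  (forall Psi, Psi ∈ F -> exists s, s ∈ Psi /\ HS s /\ ~ is_identity A s) ->
  exists G : N, is_group G /\
    forall Gamma H : N,
      is_graph Gamma -> is_aut_group H Gamma -> ~ group_isomorphic G H.
Proof.
  intros Hint; destruct symdiff_group_exists as [G [X [m [HG [HX Hop]]]]].
  exists G; split; [now exists X, m|].
  intros Gamma H _ [V [E [Y [n [HGamma [HH [HY Hn]]]]]]]
    [phi [X' [m' [Y' [n' [HG' [HH' [Hbij Hhom]]]]]]]].
  destruct (model_pair_inj _ _ _ _ _ (proj1 HG) (proj1 HG')) as [<- <-].
  destruct (model_pair_inj _ _ _ _ _ HH (proj1 HH')) as [<- <-].
  destruct HGamma as [_ [HV0 _]].
  destruct (holds_near_and _ _ (hs_near _ (val_hs V))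
    (holds_near_and _ _ (hs_near _ (val_hs E)) (hs_near _ (val_hs phi))))
    as [Psi [HPsi Hfix]].
  destruct (Hint Psi HPsi) as [s0 [HsPsi [HSs Hnid]]].
  destruct (val_surj s0 HSs) as [s <-].
  destruct (Hfix _ HsPsi) as [Hs [HsV [HsE Hsphi]]].
  destruct (induced_map_exists s V HV0 Hs HsV) as [f [Hf0 [Hfp Hf]]].
  assert (HfY : f ∈ Y) by (apply HY, (induced_map_is_graph_aut s); trivial).
  destruct (proj2 Hbij f HfY) as [g [Hgf _]].
  destruct (bij_dom_cod _ _ _ _ _ Hbij Hgf) as [HgX _].
  destruct (moved_atom (val s) Hs Hnid) as [a [b [Ha [Hab Hne]]]].
  assert (Hb : atom b) by now apply (acts_atom_iff (val s) (val a) (val b)).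
  destruct (model_singleton_exists a) as [x Hx], (model_singleton_exists b) as [x' Hx'].
  assert (HxX : x ∈ X).
  { apply HX; split; [apply Hx|]; intros w Hw; apply Hx in Hw; now destruct Hw as [-> | ->]. }
  assert (HxX' : x' ∈ X).
  { apply HX; split; [apply Hx'|]; intros w Hw; apply Hx' in Hw; now destruct Hw as [-> | ->]. }
  assert (Hxx : acts (val s) (val x) (val x')).
  { apply upair_absolute in Hx, Hx'.
    apply (acts_upair (val s) _ _ _ _ _ _ Hs (val_grounded a) (val_grounded a) Hx Hx');
      trivial. }
  destruct (bij_image _ _ _ _ Hbij HxX) as [y Hxy].
  destruct (model_image (val s) phi x y (val x') Hs Hsphi Hxy Hxx)
    as [y' [z [Hz [Hyy Hxy']]]].
  apply val_inj in Hz; subst z.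
  assert (Hmul : forall t : N, t ∈ X -> exists u k : N,
    op m g t u /\ op m t g u /\ app phi u k).
  { intros t Ht; destruct (model_symdiff_exists g t) as [u Hu].
    assert (HuX : u ∈ X).
    { apply HX; split; [apply Hu|]; intros w Hw; apply Hu in Hw.
      apply HX in HgX, Ht; destruct Hw as [[Hw _] | [_ Hw]]; [now apply HgX | now apply Ht]. }
    destruct (bij_image _ _ _ _ Hbij HuX) as [k Hk]; exists u, k.
    split; [apply Hop; auto|split; [|exact Hk]]; apply Hop.
    split; [|split; [|split; [|split]]]; trivial; [apply Hu|].
    intros w; destruct Hu as [_ Hu]; rewrite Hu; tauto. }
  assert (Hcomp : forall k1 k2 k3 : N, op n k1 k2 k3 -> is_comp k3 k1 k2).
  { intros k1 k2 k3 [q [Hq [p [Hp Hpn]]]]; apply Hn in Hpn.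
    destruct Hpn as [g1 [f1 [h1 [q' [_ [_ [Hc [Hq' Hp']]]]]]]].
    destruct (model_pair_inj _ _ _ _ _ Hp Hp') as [<- <-].
    now destruct (model_pair_inj _ _ _ _ _ Hq Hq') as [<- <-]. }
  destruct (Hmul x HxX) as [u [k [Hgx [_ Hk]]]].
  destruct (Hmul x' HxX') as [u' [k' [Hgx' [Hxg' Hk']]]].
  (* [k = f o phi {a}] and [k' = phi (s[{a}]) o f]. *)
  assert (Hkk : k = k').
  { apply (induced_map_conjugates s V f y y'); trivial.
    - destruct (bij_dom_cod _ _ _ _ _ Hbij Hxy) as [_ HyY].
      apply HY in HyY; apply HyY.
    - apply Hcomp; exact (Hhom _ _ _ _ _ _ Hgx Hgf Hxy Hk).
    - apply Hcomp; exact (Hhom _ _ _ _ _ _ Hxg' Hxy' Hgf Hk'). }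
  subst k'; assert (Huu := bij_inj _ _ _ _ _ _ Hbij Hk Hk'); subst u'.
  apply Hop in Hgx, Hgx'.
  destruct Hgx as [_ [_ [_ [_ Hu]]]], Hgx' as [_ [_ [_ [_ Hu']]]].
  specialize (Hu a); specialize (Hu' a).
  assert (Hax : a ∈ x) by (apply Hx; auto).
  assert (Hax' : ~ a ∈ x') by (intros Hc; apply Hx' in Hc; tauto).
  destruct (classic (a ∈ g)); tauto.
Qed.

End PermutationModel.

Theorem corollary1 :
  forall (M : structure) (A Sigma F : M),
    ZFA M ->
    is_atom_set A ->
    is_perm_group A Sigma ->
    is_normal_filter A Sigma F ->
    (forall Psi : M, Psi ∈ F ->
       exists sigma : M, sigma ∈ Psi /\
         hereditarily_symmetric Sigma F sigma /\ ~ is_identity A sigma) ->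
    ~ Frucht (permutation_model Sigma F) /\
    exists G : permutation_model Sigma F, is_group G /\
      forall Gamma H : permutation_model Sigma F,
        is_graph Gamma -> is_aut_group H Gamma -> ~ group_isomorphic G H.
Proof.
  intros M A Sigma F HM HA HSigma HF Hint.
  destruct (no_graph_for_symdiff_group HM A Sigma HA HSigma F HF Hint) as [G [HG Hno]].
  split; [|now exists G].
  intros HFrucht; destruct (HFrucht G HG) as [Gamma [H [HGamma [HH Hiso]]]].
  exact (Hno Gamma H HGamma HH Hiso).
Qed.
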